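(* Let $\mathbf k$ be a non-archimedean local field of characteristic different from $2$ and let $\bar\alpha\in\mathbf k^*/(\mathbf k^* )^2$ with $-1\notin\bar\alpha$. Let $T$ be an automorphism of $\mathbf D_{\bar\alpha}$. Then $T$ is a projective transformation preserving the quadratic form $Q$, i.e. $T$ belongs to $\mathrm{Isom}(\mathbf D_{\bar\alpha})$.
   Context: Elements of $\mathbf k^*/(\mathbf k^* )^2$ are regarded as subsets of $\mathbf k^*$. $Q(x,y,z)=xz-y^2$ on $\mathbf k^3$, $B(v,v')=\frac12[Q(v+v')-Q(v-v')]$. $K_{\bar\alpha}=\{\alpha x^2+y^2\in\mathbf k^*: x,y\in\mathbf k^*\}$ for any $\alpha\in\bar\alpha$ (an index $2$ subgroup of $\mathbf k^*$). $\mathbf S_{\bar\alpha}=(\mathbf k^3\setminus\{0\})/K_{\bar\alpha}$. $\mathcal C_{\bar1}=\{(a,b,c)\ne0: ac=b^2,\ a,c\text{ squares in }\mathbf k\ (\text{possibly }0)\}$. $\mathcal H_{\bar\alpha}=\{v\in\mathbf k^3: B(v,w)\in K_{\bar\alpha}\ \forall w\in\mathcal C_{\bar1}\}$ and $\mathbf D_{\bar\alpha}$ is its image in $\mathbf S_{\bar\alpha}$. $\mathrm{Isom}(\mathbf D_{\bar\alpha})$ is the group of elements of $\mathrm{GL}(3,\mathbf k)/K_{\bar\alpha}$ preserving $\mathbf D_{\bar\alpha}$; it is isomorphic to $\mathrm{PGL}(2,\mathbf k)$, with $g$ acting by $\det(g)\mathrm{Ad}(g)$, where, identifying $(x,y,z)$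 with $S=\begin{pmatrix}x & y \\ y & z\end{pmatrix}$, $\mathrm{Ad}(g)S=\det(g)^{-1}gS\,{}^tg$. A long line in $\mathbf D_{\bar\alpha}$ is a non-empty intersection with $\mathbf D_{\bar\alpha}$ of the image in $\mathbf S_{\bar\alpha}$ of a linear plane $P\subset\mathbf k^3$ on which $Q$ is isotropic; then the image of $P$ meets the image of $\mathcal C_{\bar1}$ in exactly two points. If $v\neq v'$ in $\mathbf D_{\bar\alpha}$ lie on a long line, let $w,w'\in\mathcal C_{\bar 1}$ represent these two points, $\phi=B(w,\cdot)$, $\phi'=B(w',\cdot)$; the multiplicative distance is the set $D(v,v')=\{[\phi,\phi',v,v'],[\phi',\phi,v,v']\}$, where $[\phi,\phi',v,v']=\frac{\phi(v')}{\phi(v)}\frac{\phi'(v)}{\phi'(v')}$. An automorphism of $\mathbf D_{\bar\alpha}$ is a transformation $T$ of $\mathbf D_{\bar\alpha}$ (a bijection of $\mathbf D_{\bar\alpha}$ onto itself) such that: whenever $v,v'$ lie on a long line, so do $T(v),T(v')$; and for any $v,v'$ on a long line, $D(T(v),T(v'))=D(v,v')$. *)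

(* Defs.v *)
From mathcomp Require Import all_boot all_order all_algebra.
From mathcomp Require Import boolp classical_sets functions.

Set Implicit Arguments.
Unset Strict Implicit.
Unset Printing Implicit Defensive.
Import Order.TTheory GRing.Theory Num.Theory.
Local Open Scope classical_set_scope.
Local Open Scope ring_scope.

(* A non-archimedean local field is a field that is complete for a normalized
   discrete valuation with finite residue field. The value at 0, which should
   be +oo, is left unspecified and is never used. *)
Section LocalField.
Variable k : fieldType.
Implicit Types (v : k -> int) (x y : k).

Definition discrete_valuation v : Prop :=
  [/\ forall x y, x != 0 -> y != 0 -> v (x * y) = v x + v y,
      forall x y, x != 0 -> y != 0 -> x + y != 0 ->
        Num.min (v x) (v y) <= v (x + y)
    & exists2 x, x != 0 & v x = 1].

Definition val_ge v (n : int) x : bool := (x == 0) || (n <= v x).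

Definition val_complete v : Prop :=
  forall u : nat -> k,
    (forall n : int, exists N : nat, forall i j : nat,
       (N <= i)%N -> (N <= j)%N -> val_ge v n (u i - u j)) ->
    exists l : k, forall n : int, exists N : nat, forall i : nat,
      (N <= i)%N -> val_ge v n (u i - l).

Definition finite_residue_field v : Prop :=
  exists s : seq k, forall x, val_ge v 0 x ->
    exists2 r, r \in s & val_ge v 1 (x - r).

Definition nonarch_local_field : Prop :=
  exists v, [/\ discrete_valuation v, val_complete v & finite_residue_field v].

End LocalField.

Section Geometry.
Variable k : fieldType.
Implicit Types (v w : 'cV[k]_3) (abar : set k).

(* The elements of k^* / (k^* )^2, as subsets of k^*. *)
Definition square_class abar : Prop :=
  exists2 a : k, a != 0 & abar = [set a * x ^+ 2 | x in [set x | x != 0]].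

Definition Qf v : k := v 0 0 * v 2 0 - v 1 0 ^+ 2.

Definition Bf v w : k := 2^-1 * (Qf (v + w) - Qf (v - w)).

(* The set does not depend on which element a of the square class is used. *)
Definition K_ abar : set k :=
  [set t | t != 0 /\ exists a x y : k,
     [/\ abar a, x != 0, y != 0 & t = a * x ^+ 2 + y ^+ 2]].

(* The points of (k^3 \ {0}) / K_abar are represented by the orbits of K_abar,
   as sets of vectors. *)
Definition orbit_K abar v : set 'cV[k]_3 := [set c *: v | c in K_ abar].

Definition C1 : set 'cV[k]_3 :=
  [set w | [/\ w != 0, w 0 0 * w 2 0 = w 1 0 ^+ 2,
               exists s, w 0 0 = s ^+ 2 & exists t, w 2 0 = t ^+ 2]].

Definition H_ abar : set 'cV[k]_3 :=
  [set v | forall w, C1 w -> K_ abar (Bf v w)].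

Definition D_ abar : set (set 'cV[k]_3) := orbit_K abar @` H_ abar.

Definition isotropic_plane (P : {vspace 'cV[k]_3}) : Prop :=
  \dim P = 2%N /\ exists v, [/\ v \in P, v != 0 & Qf v = 0].

Definition plane_image abar (P : {vspace 'cV[k]_3}) : set (set 'cV[k]_3) :=
  [set orbit_K abar v | v in [set v | v \in P /\ v != 0]].

Definition long_line_of abar (P : {vspace 'cV[k]_3})
    (L : set (set 'cV[k]_3)) : Prop :=
  [/\ isotropic_plane P, L = D_ abar `&` plane_image abar P & L !=set0].

Definition long_line abar (L : set (set 'cV[k]_3)) : Prop :=
  exists P, long_line_of abar P L.

Definition on_long_line abar (p p' : set 'cV[k]_3) : Prop :=
  exists L, [/\ long_line abar L, L p & L p'].

(* [phi, phi', v, v'] for phi = B(w, .) and phi' = B(w', .). *)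
Definition cross_ratio w w' v v' : k :=
  (Bf w v' / Bf w v) * (Bf w' v / Bf w' v').

(* For p <> p' in D_abar the plane P is unique; w and w' represent the two
   points at which the image of P meets the image of C1. The cross-ratio does
   not depend on the representatives w, w', v, v'. *)
Definition mult_dist abar (p p' : set 'cV[k]_3) : set k :=
  [set t | exists P L w w' v v',
     [/\ long_line_of abar P L /\ (L p /\ L p'),
         C1 w /\ plane_image abar P (orbit_K abar w),
         C1 w' /\ plane_image abar P (orbit_K abar w'),
         orbit_K abar w <> orbit_K abar w'
       & (p = orbit_K abar v /\ p' = orbit_K abar v') /\
         [set cross_ratio w w' v v'; cross_ratio w' w v v'] t]].

(* T is a map on all sets of vectors, but only its restriction to D_abar
   matters. *)
Definition automorphism abar (T : set 'cV[k]_3 -> set 'cV[k]_3) : Prop :=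
  [/\ set_bij (D_ abar) (D_ abar) T,
      forall p p', D_ abar p -> D_ abar p' ->
        on_long_line abar p p' -> on_long_line abar (T p) (T p')
    & forall p p', D_ abar p -> D_ abar p' -> p <> p' ->
        on_long_line abar p p' ->
        mult_dist abar (T p) (T p') = mult_dist abar p p'].

(* The action of GL(3, k) on orbits; it factors through GL(3, k) / K_abar. *)
Definition mx_act (M : 'M[k]_3) (p : set 'cV[k]_3) : set 'cV[k]_3 :=
  [set M *m v | v in p].

(* The class of M in GL(3, k) / K_abar belongs to Isom(D_abar). *)
Definition Isom abar (M : 'M[k]_3) : Prop :=
  M \in unitmx /\ [set mx_act M p | p in D_ abar] = D_ abar.

(* The projective transformation defined by M preserves Q: some non-zero
   multiple of M is an isometry of Q. *)
Definition proj_preserves_Q (M : 'M[k]_3) : Prop :=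
  exists2 c : k, c != 0 & forall v, Qf (c *: (M *m v)) = Qf v.

End Geometry.

(* Main.v *)
Require Import Defs.
From mathcomp Require Import all_boot all_order all_algebra.
From mathcomp Require Import boolp classical_sets functions.
From mathcomp Require Import ring zify.

(* Every point of D has a unique representative (1, u, u^2 + a), and Q takes on
   it the value a, where a runs over a union A of square classes not containing
   -1. A pair of points v, v' lies on a long line iff B(v,v')^2 - 4 Q(v) Q(v')
   is a non-zero square, and then the multiplicative distance {t, 1/t}
   determines t + 1/t + 2 = B(v,v')^2 / (Q(v) Q(v')). So T preserves this
   invariant on such pairs, and this is all that is used.
   Squares are open in k. For three points of a long line, the invariants
   determine the Gram determinant up to the sign of one product; when two of
   the points are close, the wrong sign would make -Q a square at one of the
   images. Hence T maps the line u = 0 into a line. After composition with an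
   element of PGL(2, k), T acts on this line as a -> kappa a. Comparing a point
   (u, b) with infinitely many points (0, a), a -> 0, shows that kappa is a
   square and, once kappa = 1, that T(u, b) = (u, b) or (-u, b); the sign is
   then propagated from one point to all the others. *)

Set Implicit Arguments.
Unset Strict Implicit.
Unset Printing Implicit Defensive.
Import Order.TTheory GRing.Theory Num.Theory.
Local Open Scope classical_set_scope.
Local Open Scope ring_scope.

(** * Squares in a local field *)

Section Valuation.
Variables (k : fieldType) (v : k -> int).
Hypothesis v_val : discrete_valuation v.

Lemma valM x y : x != 0 -> y != 0 -> v (x * y) = v x + v y.
Proof. by case: v_val => vM _ _; apply: vM. Qed.

Lemma val1 : v 1 = 0.
Proof.
have := valM (oner_neq0 k) (oner_neq0 k); rewrite mulr1 => h.
by apply: (addrI (v 1)); rewrite -h addr0.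
Qed.

Lemma valN1 : v (-1) = 0.
Proof.
have N1 : (-1 : k) != 0 by rewrite oppr_eq0 oner_eq0.
have := valM N1 N1; rewrite mulrNN mulr1 val1; lia.
Qed.

Lemma val_geM m n x y :
  val_ge v m x -> val_ge v n y -> val_ge v (m + n) (x * y).
Proof.
rewrite /val_ge mulf_eq0.
case: eqP => //= /eqP x0; case: eqP => //= /eqP y0.
by rewrite valM // => ? ?; rewrite lerD.
Qed.

Lemma val_geD n x y : val_ge v n x -> val_ge v n y -> val_ge v n (x + y).
Proof.
rewrite /val_ge; case: (eqVneq x 0) => [->|x0]; first by rewrite add0r.
case: (eqVneq y 0) => [->|y0]; first by rewrite addr0 (negPf x0).
case: (eqVneq (x + y) 0) => //= xy0 vx vy.
case: v_val => _ vD _; apply: le_trans (vD _ _ x0 y0 xy0).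
by rewrite le_min vx vy.
Qed.

Lemma val_geN n x : val_ge v n (- x) = val_ge v n x.
Proof.
rewrite /val_ge oppr_eq0; case: (eqVneq x 0) => //= x0.
by rewrite -mulN1r valM ?oppr_eq0 ?oner_eq0 // valN1 add0r.
Qed.

Lemma val_geB n x y : val_ge v n x -> val_ge v n y -> val_ge v n (x - y).
Proof. by move=> ? ?; apply: val_geD; rewrite ?val_geN. Qed.

Lemma val_ge_le m n x : m <= n -> val_ge v n x -> val_ge v m x.
Proof. by rewrite /val_ge => mn /orP[->//|h]; rewrite (le_trans mn h) orbT. Qed.

Lemma val_ge_self x : val_ge v (v x) x.
Proof. by rewrite /val_ge lexx orbT. Qed.

Lemma val_ge_eq0 x : (forall n : nat, val_ge v n%:Z x) -> x = 0.
Proof.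
move=> h; apply/eqP/negPn/negP => x0.
have := h (absz (v x)).+1; rewrite /val_ge (negPf x0) /=; lia.
Qed.

(** Applied to the quotient of [p - p.[0]] by [X], this bounds the distance from [p.[e]] to [p.[0]]
    in terms of [v e]. *)
Lemma val_horner_bounded (p : {poly k}) :
  exists m, forall e, val_ge v 0 e -> val_ge v m p.[e].
Proof.
elim/poly_ind: p => [|p c [m IH]].
  by exists 0 => e _; rewrite horner0 /val_ge eqxx.
exists (Num.min m (v c)) => e e0; rewrite !hornerE.
apply: val_geD.
  apply: (@val_ge_le _ (m + 0)); first by rewrite addr0 ge_min lexx.
  by apply: val_geM => //; apply: IH.
by apply: (@val_ge_le _ (v c)); [rewrite ge_min lexx orbT|apply: val_ge_self].
Qed.

Lemma val_exp_uniformizer x n : x != 0 -> v x = 1 -> v (x ^+ n) = n%:Z.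
Proof.
move=> x0 vx; elim: n => [|n IH]; first by rewrite expr0 val1.
by rewrite exprS valM ?expf_neq0 // vx IH; lia.
Qed.

Hypothesis v_complete : val_complete v.

(* The substitution [y = 1 + 2z] turns [y^2 = 1 + 4c] into the fixed-point
   equation [z = c - z^2], which is contracting for [v c > 0]. *)
Lemma sqrt_one_plus_4 c : val_ge v 1 c -> exists y, 1 + 4 * c = y ^+ 2.
Proof.
move=> vc; pose z n := iter n (fun z => c - z ^+ 2) 0.
have zS n : z n.+1 = c - z n ^+ 2 by [].
have vz n : val_ge v 1 (z n).
  elim: n => [|n IH]; first by rewrite /val_ge eqxx.
  rewrite zS; apply: val_geB => //.
  by apply: (@val_ge_le _ (1 + 1)) => //; rewrite expr2; apply: val_geM.
have dz n : val_ge v n%:Z (z n.+1 - z n).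
  elim: n => [|n IH].
    by rewrite /= expr2 mulr0 !subr0; apply: val_ge_le vc.
  have -> : z n.+2 - z n.+1 = (z n.+1 - z n) * - (z n.+1 + z n).
    by rewrite (zS n.+1) [X in _ - X]zS; ring.
  have -> : n.+1%:Z = n%:Z + 1 by lia.
  by apply: val_geM => //; rewrite val_geN; apply: val_geD.
have dzm n m : val_ge v n%:Z (z (n + m)%N - z n).
  elim: m => [|m IH]; first by rewrite addn0 subrr /val_ge eqxx.
  have -> : z (n + m.+1)%N - z n = z (n + m).+1 - z (n + m)%N
                                   + (z (n + m)%N - z n).
    by rewrite addnS; ring.
  by apply: val_geD => //; apply: val_ge_le (dz _); lia.
have [|l zl] := v_complete (u := z).
  move=> n; exists (absz n) => i j hi hj.
  have h i' : (absz n <= i')%N -> val_ge v n (z i' - z (absz n)).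
    by move=> hi'; rewrite -(subnKC hi'); apply: val_ge_le (dzm _ _); lia.
  have -> : z i - z j = (z i - z (absz n)) - (z j - z (absz n)) by ring.
  by apply: val_geB; apply: h.
have vl : val_ge v 0 l.
  have [N /(_ _ (leqnn _)) zN] := zl 0.
  have -> : l = z N - (z N - l) by ring.
  by apply: val_geB => //; apply: val_ge_le (vz _).
have fix_l : l + l ^+ 2 - c = 0.
  apply: val_ge_eq0 => n.
  have [N zN] := zl n%:Z.
  have -> : l + l ^+ 2 - c = - (z N.+1 - l) - (z N - l) * (z N + l).
    by rewrite zS; ring.
  apply: val_geB; first by rewrite val_geN; apply: zN.
  rewrite -[n%:Z]addr0; apply: val_geM; first exact: zN.
  by apply: val_geD => //; apply: val_ge_le (vz _).
exists (1 + 2 * l).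
have -> : c = l + l ^+ 2 by apply/eqP; rewrite eq_sym -subr_eq0 fix_l.
ring.
Qed.

(** In [p.[e] = r ^+ 2 * (1 + 4 * c)] the element [c] is small when [e] is, so [sqrt_one_plus_4]
    applies. Keeping the factor 4 also covers residue characteristic 2. *)
Lemma square_near (p : {poly k}) (r : k) :
  (2 : k) != 0 -> r != 0 -> p.[0] = r ^+ 2 ->
  exists n : nat, forall e, val_ge v n%:Z e ->
    exists2 s, s != 0 & p.[e] = s ^+ 2.
Proof.
move=> two0 r0 p0.
have /factor_theorem[q pq] : root (p - (p.[0])%:P) 0.
  by rewrite /root !hornerE subrr.
have four0 : (4 : k) != 0 by rewrite (natrM _ 2 2) mulf_neq0.
pose d := 4 * r ^+ 2.
have d0 : d != 0 by rewrite mulf_neq0 ?expf_neq0.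
have [m qm] := val_horner_bounded q.
(* With [c = q.[e] * e / d], the first term gives [c] valuation at least 1; the second does the same
   for [4 * c], so that [1 + 4 * c] is not 0. *)
exists (absz (1 - m - v d^-1)%R + absz (1 - v 4 - m - v d^-1)%R)%N => e ve.
have {}qm : val_ge v m q.[e] by apply: qm; apply: val_ge_le ve; lia.
have pe : p.[e] = r ^+ 2 * (1 + 4 * (q.[e] * e * d^-1)).
  have -> : p = q * ('X - 0%:P) + (p.[0])%:P by rewrite -pq subrK.
  by rewrite hornerD hornerM hornerXsubC hornerC p0 /d; field; rewrite four0 r0.
have vc : val_ge v (Num.max 1 (1 - v 4)) (q.[e] * e * d^-1).
  have := val_geM (val_geM qm ve) (val_ge_self d^-1).
  by apply: val_ge_le; lia.
have [y Ey] : exists y, 1 + 4 * (q.[e] * e * d^-1) = y ^+ 2.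
  by apply: sqrt_one_plus_4; apply: val_ge_le vc; lia.
exists (r * y); last by rewrite pe Ey; ring.
rewrite mulf_neq0 //; apply/eqP => y0.
move: Ey; rewrite y0 expr2 mulr0 => /eqP; rewrite addr_eq0 => /eqP E.
have : val_ge v 1 (-1 : k).
  rewrite -[-1]/(- (1)) E opprK.
  by apply: val_ge_le (val_geM (val_ge_self 4) vc); lia.
by rewrite /val_ge oppr_eq0 oner_eq0 valN1.
Qed.

End Valuation.

Lemma square_near_all (k : fieldType) (ps : seq {poly k}) (bad : seq k) :
  nonarch_local_field k -> (2 : k) != 0 ->
  (forall p, p \in ps -> exists2 r, r != 0 & p.[0] = r ^+ 2) ->
  exists2 e, e \notin bad &
    forall p, p \in ps -> exists2 s, s != 0 & p.[e] = s ^+ 2.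
Proof.
move=> [v [v_val v_compl _]] two0 ps0.
have [n ps_n] : exists n : nat, forall p, p \in ps -> forall e,
    val_ge v n%:Z e -> exists2 s, s != 0 & p.[e] = s ^+ 2.
  elim: ps ps0 => [|p ps IH] ps0; first by exists 0%N.
  have [|n1 h1] := IH; first by move=> q qps; apply: ps0; rewrite inE qps orbT.
  have [r r0 pr] := ps0 p (mem_head _ _).
  have [n2 h2] := square_near v_val v_compl two0 r0 pr.
  exists (n1 + n2)%N => q; rewrite inE => /orP[/eqP->|qps] e ve.
    by apply: h2; apply: val_ge_le ve; lia.
  by apply: h1 => //; apply: val_ge_le ve; lia.
have [_ _ [x x0 vx]] := v_val.
(* Powers of a uniformizer: small, distinct, and one more than [bad] has entries. *)
pose es := [seq x ^+ (n + i) | i <- iota 0 (size bad).+1].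
have es_uniq : uniq es.
  rewrite map_inj_uniq ?iota_uniq // => i j Eij.
  have := congr1 v Eij; rewrite /= !(val_exp_uniformizer v_val) //; lia.
have [e e_es e_bad] : exists2 e, e \in es & e \notin bad.
  apply: contrapT => no_e.
  suff : (size es <= size bad)%N by rewrite size_map size_iota ltnn.
  apply: uniq_leq_size => // e e_es; apply: contrapT => e_bad.
  by apply: no_e; exists e => //; apply/negP.
exists e => // p /ps_n; apply.
have /mapP[i _ ->] := e_es.
by rewrite /val_ge (val_exp_uniformizer v_val) //; lia.
Qed.

(** Turns a condition [s ^+ 2 != d] into the avoidance of a finite list, as [square_near_all]
    requires. *)
Lemma square_roots_seq (k : fieldType) (d : k) :
  exists l : seq k, forall s, s ^+ 2 = d -> s \in l.
Proof.
have [[s0 <-]|no] := pselect (exists s0, s0 ^+ 2 = d).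
  by exists [:: s0; - s0] => s /eqP; rewrite eqf_sqr !inE.
by exists [::] => s Es; case: no; exists s.
Qed.

(** * The quadratic form and its similitudes *)

Section Symmetries.
Variable k : fieldType.
Hypothesis two0 : (2 : k) != 0.
Implicit Types (v w : 'cV[k]_3) (p q r s u a : k).

Definition vec3 (x y z : k) : 'cV[k]_3 := \col_i [:: x; y; z]`_i.

Lemma vec3E x y z :
  (vec3 x y z 0 0 = x) * (vec3 x y z 1 0 = y) * (vec3 x y z 2 0 = z).
Proof. by rewrite /vec3 !mxE. Qed.

Lemma col3P v w :
  v 0 0 = w 0 0 -> v 1 0 = w 1 0 -> v 2 0 = w 2 0 -> v = w.
Proof.
move=> e0 e1 e2; apply/matrixP => i j; rewrite (ord1 j).
by case: i => [[|[|[|//]]] lti]; [move: e0|move: e1|move: e2];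
  congr (_ = _); congr (fun_of_matrix _ _ _); apply: val_inj.
Qed.

Lemma vec3_eta v : v = vec3 (v 0 0) (v 1 0) (v 2 0).
Proof. by apply: col3P; rewrite vec3E. Qed.

Lemma col3_neq0 v : v != 0 -> [|| v 0 0 != 0, v 1 0 != 0 | v 2 0 != 0].
Proof.
apply: contraR; rewrite !negb_or !negbK => /and3P[/eqP e0 /eqP e1 /eqP e2].
by apply/eqP/col3P; rewrite mxE.
Qed.

Lemma BfE v w : Bf v w = v 0 0 * w 2 0 + v 2 0 * w 0 0 - 2 * (v 1 0 * w 1 0).
Proof. by rewrite /Bf /Qf !mxE; field. Qed.

Lemma QfZ c v : Qf (c *: v) = c ^+ 2 * Qf v.
Proof. by rewrite /Qf !mxE; ring. Qed.

Lemma BfZl c v w : Bf (c *: v) w = c * Bf v w.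
Proof. by rewrite !BfE !mxE; ring. Qed.

Lemma BfZr c v w : Bf v (c *: w) = c * Bf v w.
Proof. by rewrite !BfE !mxE; ring. Qed.

Lemma Bf_diag v : 2 * Qf v = Bf v v.
Proof. by rewrite BfE /Qf; ring. Qed.

Lemma BfC v w : Bf v w = Bf w v.
Proof. by rewrite !BfE; ring. Qed.

Lemma Bf_combr (c d : k) v w x :
  Bf v (c *: w + d *: x) = c * Bf v w + d * Bf v x.
Proof. by rewrite !BfE !mxE; ring. Qed.

Lemma Bf_comb (c d c' d' : k) v w :
  Bf (c *: v + d *: w) (c' *: v + d' *: w) =
  2 * (c * c' * Qf v + d * d' * Qf w) + (c * d' + d * c') * Bf v w.
Proof. by rewrite !BfE /Qf !mxE; ring. Qed.

Lemma Qf_comb (c d : k) v w :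
  Qf (c *: v + d *: w) = c ^+ 2 * Qf v + d ^+ 2 * Qf w + c * d * Bf v w.
Proof. by rewrite BfE /Qf !mxE; ring. Qed.

(* The matrix of [S |-> g S g^T] for [g = [[p, q], [r, s]]]. *)
Definition sym2 p q r s : 'M[k]_3 :=
  \matrix_(i, j) (nth [::] [:: [:: p ^+ 2; 2 * (p * q); q ^+ 2];
                               [:: p * r; p * s + q * r; q * s];
                               [:: r ^+ 2; 2 * (r * s); s ^+ 2]] i)`_j.

Lemma sym2E p q r s v :
  let x := v 0 0 in let y := v 1 0 in let z := v 2 0 in
  sym2 p q r s *m v =
    vec3 (p ^+ 2 * x + 2 * (p * q) * y + q ^+ 2 * z)
         (p * r * x + (p * s + q * r) * y + q * s * z)
         (r ^+ 2 * x + 2 * (r * s) * y + s ^+ 2 * z).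
Proof.
move=> x y z; apply: col3P; rewrite !vec3E mxE !big_ord_recl big_ord0 addr0;
  rewrite !mxE /= /x /y /z addrA; congr (_ + _ * v _ 0 + _ * v _ 0);
  exact: val_inj.
Qed.

Lemma sym2M p q r s p' q' r' s' v :
  sym2 p q r s *m (sym2 p' q' r' s' *m v) =
  sym2 (p * p' + q * r') (p * q' + q * s') (r * p' + s * r') (r * q' + s * s')
    *m v.
Proof. by apply: col3P; rewrite !sym2E !vec3E; ring. Qed.

Lemma sym2_adj p q r s v :
  sym2 s (- q) (- r) p *m (sym2 p q r s *m v) = (p * s - q * r) ^+ 2 *: v.
Proof. by apply: col3P; rewrite !sym2E !vec3E !mxE; ring. Qed.

Lemma sym2_adjr (p q r s : k) v :
  sym2 p q r s *m (sym2 s (- q) (- r) p *m v) = (p * s - q * r) ^+ 2 *: v.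
Proof. by apply: col3P; rewrite !sym2E !vec3E !mxE; ring. Qed.

(** [Qf] is the determinant of the symmetric matrix S, and det(g S g^T) = det(g)^2 det(S). *)
Lemma Qf_sym2 p q r s v :
  Qf (sym2 p q r s *m v) = (p * s - q * r) ^+ 2 * Qf v.
Proof. by rewrite /Qf !sym2E !vec3E; ring. Qed.

Lemma Bf_sym2 p q r s v w :
  Bf (sym2 p q r s *m v) (sym2 p q r s *m w) = (p * s - q * r) ^+ 2 * Bf v w.
Proof. by rewrite !BfE !sym2E !vec3E; ring. Qed.

Definition std u a := vec3 1 u (u ^+ 2 + a).

Lemma Qf_std u a : Qf (std u a) = a.
Proof. by rewrite /Qf !vec3E; ring. Qed.

Lemma Bf_std u a u' a' : Bf (std u a) (std u' a') = (u - u') ^+ 2 + a + a'.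
Proof. by rewrite BfE !vec3E; ring. Qed.

(** The determinant of the matrix with columns [v1], [v2], [v3]. *)
Definition tri v1 v2 v3 : k :=
  v1 0 0 * (v2 1 0 * v3 2 0 - v2 2 0 * v3 1 0)
  + v1 1 0 * (v2 2 0 * v3 0 0 - v2 0 0 * v3 2 0)
  + v1 2 0 * (v2 0 0 * v3 1 0 - v2 1 0 * v3 0 0).

(** The left side is half the Gram determinant of the three vectors for [Bf], and the matrix of [Bf]
    has determinant 2. *)
Lemma gram3 v1 v2 v3 :
  4 * (Qf v1 * Qf v2 * Qf v3) + Bf v1 v2 * Bf v1 v3 * Bf v2 v3
  - (Qf v1 * Bf v2 v3 ^+ 2 + Qf v2 * Bf v1 v3 ^+ 2 + Qf v3 * Bf v1 v2 ^+ 2)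
  = tri v1 v2 v3 ^+ 2.
Proof. by rewrite !BfE /Qf /tri; ring. Qed.

(** The first hypothesis makes [v1] and [v2] independent, so [v3] and [v4] both lie in the plane
    they span. *)
Lemma tri_trans v1 v2 v3 v4 :
  Bf v1 v2 ^+ 2 != 4 * (Qf v1 * Qf v2) ->
  tri v1 v2 v3 = 0 -> tri v1 v2 v4 = 0 -> tri v1 v3 v4 = 0.
Proof.
move=> indep t3 t4.
pose n0 := v1 1 0 * v2 2 0 - v1 2 0 * v2 1 0.
pose n1 := v1 2 0 * v2 0 0 - v1 0 0 * v2 2 0.
pose n2 := v1 0 0 * v2 1 0 - v1 1 0 * v2 0 0.
have E3 : n0 * v3 0 0 + n1 * v3 1 0 + n2 * v3 2 0 = 0.
  by rewrite -t3 /tri /n0 /n1 /n2; ring.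
have E4 : n0 * v4 0 0 + n1 * v4 1 0 + n2 * v4 2 0 = 0.
  by rewrite -t4 /tri /n0 /n1 /n2; ring.
have [//|t0] := eqVneq (tri v1 v3 v4) 0.
(* The cross product [(n0, n1, n2)] of [v1] and [v2] is orthogonal to [v1], [v3] and [v4]; if these
   were independent it would vanish, by Cramer's rule. *)
have N0 : n0 = 0.
  apply: (mulIf t0); rewrite mul0r.
  transitivity
    ((n0 * v3 0 0 + n1 * v3 1 0 + n2 * v3 2 0) *
       (v4 1 0 * v1 2 0 - v4 2 0 * v1 1 0)
     + (n0 * v4 0 0 + n1 * v4 1 0 + n2 * v4 2 0) *
       (v1 1 0 * v3 2 0 - v1 2 0 * v3 1 0)).
    by rewrite /tri /n0 /n1 /n2; ring.
  by rewrite E3 E4; ring.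
have N1 : n1 = 0.
  apply: (mulIf t0); rewrite mul0r.
  transitivity
    ((n0 * v3 0 0 + n1 * v3 1 0 + n2 * v3 2 0) *
       (v4 2 0 * v1 0 0 - v4 0 0 * v1 2 0)
     + (n0 * v4 0 0 + n1 * v4 1 0 + n2 * v4 2 0) *
       (v1 2 0 * v3 0 0 - v1 0 0 * v3 2 0)).
    by rewrite /tri /n0 /n1 /n2; ring.
  by rewrite E3 E4; ring.
have N2 : n2 = 0.
  apply: (mulIf t0); rewrite mul0r.
  transitivity
    ((n0 * v3 0 0 + n1 * v3 1 0 + n2 * v3 2 0) *
       (v4 0 0 * v1 1 0 - v4 1 0 * v1 0 0)
     + (n0 * v4 0 0 + n1 * v4 1 0 + n2 * v4 2 0) *
       (v1 0 0 * v3 1 0 - v1 1 0 * v3 0 0)).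
    by rewrite /tri /n0 /n1 /n2; ring.
  by rewrite E3 E4; ring.
case/negP: indep; apply/eqP.
have -> : Bf v1 v2 ^+ 2 = 4 * (Qf v1 * Qf v2) + n1 ^+ 2 - 4 * (n0 * n2).
  by rewrite BfE /Qf /n0 /n1 /n2; ring.
by rewrite N0 N1; ring.
Qed.

(** A binary form n0 X^2 + n1 XY + n2 Y^2 whose discriminant is a non-zero square is a product (pX +
    qY)(rX + sY) of independent linear forms. The middle row of [sym2 p q r s] is then
    [(n0, n1, n2)]. *)
Lemma factor_binary_form n0 n1 n2 d :
  d != 0 -> n1 ^+ 2 - 4 * (n0 * n2) = d ^+ 2 ->
  exists p q r s,
    [/\ p * s - q * r != 0, p * r = n0, p * s + q * r = n1 & q * s = n2].
Proof.
move=> d0 E; have [n00|n00] := eqVneq n0 0.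
  exists 0, 1, n1, n2; split; rewrite ?n00 ?mul0r ?add0r ?mul1r //.
  rewrite oppr_eq0; apply: contraNneq d0 => n10.
  by rewrite -sqrf_eq0 -E n00 n10; apply/eqP; ring.
exists 1, ((n1 - d) / (2 * n0)), n0, ((n1 + d) / 2); split.
- suff -> : 1 * ((n1 + d) / 2) - (n1 - d) / (2 * n0) * n0 = d by [].
  by field; rewrite two0 n00.
- by rewrite mul1r.
- by field; rewrite two0 n00.
- apply: (mulfI n00); apply: (mulfI two0); apply: (mulfI two0).
  transitivity (n1 ^+ 2 - d ^+ 2); first by field; rewrite two0 n00.
  by rewrite -E; ring.
Qed.

End Symmetries.

(** * Rigidity *)

Section Rigidity.
Variable k : fieldType.
Hypothesis two0 : (2 : k) != 0.
Hypothesis squares_open : forall (ps : seq {poly k}) (bad : seq k),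
  (forall p, p \in ps -> exists2 r, r != 0 & p.[0] = r ^+ 2) ->
  exists2 e, e \notin bad &
    forall p, p \in ps -> exists2 s, s != 0 & p.[e] = s ^+ 2.
Variables (A : k -> Prop) (a0 : k).
Hypothesis A_a0 : A a0.
Hypothesis A_sq : forall c a, c != 0 -> A a -> A (c ^+ 2 * a).
Hypothesis A_nsq : forall a, A a -> forall s, - a != s ^+ 2.
Implicit Types (v w : 'cV[k]_3) (p q r s u a : k) (F : k -> k -> 'cV[k]_3).

Let horner_ring :=
  (@hornerD k, @hornerN k, @hornerM k, @horner_exp k, @hornerC k, @hornerX k).

(* On the plane spanned by [std u a] and [std u' a'], the form [Q] is isotropic
   and non-degenerate iff [B^2 - 4 Q Q'] is a non-zero square. *)
Definition coline u a u' a' : Prop :=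
  exists2 r, r != 0 & ((u - u') ^+ 2 + a + a') ^+ 2 - 4 * (a * a') = r ^+ 2.

(** Equality of the invariants B^2 / (Q Q'), cross-multiplied. It is homogeneous in each vector, so
    [F] may be any choice of representatives of the images. *)
Definition preserves_dist F : Prop :=
  (forall u a, A a -> forall s, - Qf (F u a) != s ^+ 2) /\
  (forall u a u' a', A a -> A a' -> coline u a u' a' ->
    Bf (F u a) (F u' a') ^+ 2 * (a * a') =
    ((u - u') ^+ 2 + a + a') ^+ 2 * (Qf (F u a) * Qf (F u' a'))).

Lemma neq0_of_nsq a : (forall s, - a != s ^+ 2) -> a != 0.
Proof. by move/(_ 0); apply: contraNneq => ->; rewrite oppr0 expr2 mulr0. Qed.

Lemma A_neq0 a : A a -> a != 0.
Proof. by move=> Aa; apply/neq0_of_nsq/A_nsq. Qed.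

Lemma Q_neq0 F u a : preserves_dist F -> A a -> Qf (F u a) != 0.
Proof. by move=> [h _] Aa; apply/neq0_of_nsq/h. Qed.

Lemma preserves_dist_sym2 p q r s F : p * s - q * r != 0 ->
  preserves_dist F -> preserves_dist (fun u a => sym2 p q r s *m F u a).
Proof.
set d := p * s - q * r => d0 [FQ FB]; split.
  move=> u a Aa t; rewrite /= Qf_sym2 -/d; apply/negP => /eqP E.
  case/negP: (FQ u a Aa (t / d)); apply/eqP.
  by rewrite expr_div_n -E; field.
move=> u a u' a' Aa Aa' /(FB _ _ _ _ Aa Aa') E.
rewrite /= (Bf_sym2 two0) !Qf_sym2 -/d.
transitivity (d ^+ 4 * (Bf (F u a) (F u' a') ^+ 2 * (a * a'))); first by ring.
by rewrite E; ring.
Qed.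

(** On the line u = 0 the discriminant is [(a - a') ^+ 2], so [coline] fails only for [a = a'],
    where the identity is trivial. *)
Lemma preserves_dist_vert F a a' : preserves_dist F -> A a -> A a' ->
  Bf (F 0 a) (F 0 a') ^+ 2 * (a * a') =
  (a + a') ^+ 2 * (Qf (F 0 a) * Qf (F 0 a')).
Proof.
move=> [_ FB] Aa Aa'; have [<-|aa'] := eqVneq a a'.
  by rewrite (BfE two0) /Qf; ring.
rewrite FB //; first by ring.
by exists (a - a'); [rewrite subr_eq0|ring].
Qed.

(* The squared entries of the Gram matrix are those of a linearly dependent
   triple, so the determinant [tri ^+ 2] can only be non-zero if the product of
   the off-diagonal entries changes sign; the hypotheses on [r] and [- Qf v1]
   then prevent the determinant from being a square. *)
Lemma dependent_triple v1 v2 v3 a1 a2 a3 :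
  a1 != 0 -> a2 != 0 -> a3 != 0 ->
  (forall s, - Qf v1 != s ^+ 2) ->
  Bf v1 v2 ^+ 2 * (a1 * a2) = (a1 + a2) ^+ 2 * (Qf v1 * Qf v2) ->
  Bf v1 v3 ^+ 2 * (a1 * a3) = (a1 + a3) ^+ 2 * (Qf v1 * Qf v3) ->
  Bf v2 v3 ^+ 2 * (a2 * a3) = (a2 + a3) ^+ 2 * (Qf v2 * Qf v3) ->
  a1 + a2 = 0 \/
    (exists2 r, r != 0 & 2 * (a1 + a2) * (a1 + a3) * (a2 + a3) = a1 * r ^+ 2) ->
  Qf v2 != 0 -> Qf v3 != 0 ->
  tri v1 v2 v3 = 0.
Proof.
move=> a10 a20 a30 nsq E12 E13 E23 hr q20 q30.
have gram := gram3 two0 v1 v2 v3; have q10 := neq0_of_nsq nsq.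
move: gram E12 E13 E23 nsq q10 q20 q30.
set q1 := Qf v1; set q2 := Qf v2; set q3 := Qf v3; set D := tri _ _ _.
set b12 := Bf v1 v2; set b13 := Bf v1 v3; set b23 := Bf v2 v3.
move=> gram E12 E13 E23 nsq q10 q20 q30.
pose P := b12 * b13 * b23; pose S := (a1 + a2) * (a1 + a3) * (a2 + a3).
have aD : a1 * a2 * a3 * D ^+ 2 = P * (a1 * a2 * a3) - S * (q1 * q2 * q3).
  rewrite -gram.
  transitivity (4 * (a1 * a2 * a3) * (q1 * q2 * q3) + P * (a1 * a2 * a3)
    - (q1 * a1 * (b23 ^+ 2 * (a2 * a3)) + q2 * a2 * (b13 ^+ 2 * (a1 * a3))
       + q3 * a3 * (b12 ^+ 2 * (a1 * a2)))); first by rewrite /P; ring.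
  by rewrite E12 E13 E23 /S; ring.
have a123 : a1 * a2 * a3 != 0 by rewrite !mulf_neq0.
have D0 : P * (a1 * a2 * a3) = S * (q1 * q2 * q3) -> D = 0.
  move=> E; apply/eqP; rewrite -sqrf_eq0; apply/eqP.
  by apply: (mulfI a123); rewrite aD E subrr mulr0.
have : (P * (a1 * a2 * a3)) ^+ 2 == (S * (q1 * q2 * q3)) ^+ 2.
  apply/eqP; transitivity ((b12 ^+ 2 * (a1 * a2)) * (b13 ^+ 2 * (a1 * a3)) *
    (b23 ^+ 2 * (a2 * a3))); first by rewrite /P; ring.
  by rewrite E12 E13 E23 /S; ring.
rewrite eqf_sqr => /orP[/eqP/D0//|/eqP PS].
(* If [a1 + a2 = 0] then [S = 0] and the two signs agree. *)
case: hr => [a12|[r r0 Er]].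
  by apply: D0; rewrite PS /S a12; ring.
have a230 : a2 + a3 != 0.
  apply: contraNneq (mulf_neq0 a10 (expf_neq0 2 r0)) => a23.
  by rewrite -Er a23 mulr0.
have b0 : b23 != 0.
  apply: contraNneq (mulf_neq0 (expf_neq0 2 a230) (mulf_neq0 q20 q30)) => b0.
  by rewrite -E23 b0 expr2 !mul0r.
(* With the wrong sign, [a1 * a2 * a3 * D ^+ 2 = - 2 * S * (q1 * q2 * q3)]; multiplying by
   [(a2 + a3) ^+ 2] and using [E23] and [Er] exhibits [- q1] as a square. *)
case/negP: (nsq (D * (a2 + a3) / (r * b23))); apply/eqP.
apply: (mulIf (expf_neq0 2 (mulf_neq0 r0 b0))).
apply: (mulfI a123).
transitivity (- (a1 * r ^+ 2) * q1 * (b23 ^+ 2 * (a2 * a3))); first by ring.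
rewrite E23 -Er.
transitivity (a1 * a2 * a3 * D ^+ 2 * (a2 + a3) ^+ 2); last first.
  by field; rewrite r0 b0.
by rewrite aD PS /S; ring.
Qed.

(** All [F 0 a] lie in the plane of [F 0 a0] and [F 0 a2]: an auxiliary point [a4] near [a0] is
    shown dependent with [a0] and each of [a2], [a]. A similitude then moves this plane to y = 0. *)
Lemma straighten_vertical F : preserves_dist F ->
  exists p q r s, p * s - q * r != 0 /\
    forall a, A a -> (sym2 p q r s *m F 0 a) 1 0 = 0.
Proof.
move=> HF; have a00 := A_neq0 A_a0.
have [l lP] := square_roots_seq (-1 : k).
(* The exclusions make [a2 = c ^+ 2 * a0] different from 0, [a0] and [- a0]. *)
have [c cbad _] : exists2 c, c \notin [:: 0, 1, -1 & l] &
    forall p : {poly k}, p \in [::] -> exists2 s, s != 0 & p.[c] = s ^+ 2.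
  exact: squares_open.
move: cbad; rewrite !inE !negb_or => /and4P[c0 c1 cN1 cl].
have {cl} c2 : 1 + c ^+ 2 != 0.
  apply: contra cl => /eqP E; apply: lP; apply/eqP.
  by rewrite -subr_eq0 opprK addrC E.
have c21 : 1 - c ^+ 2 != 0.
  by rewrite subr_eq0 eq_sym -[1](expr1n _ 2) eqf_sqr negb_or c1.
pose a2 := c ^+ 2 * a0; have Aa2 : A a2 by apply: A_sq.
have plane a : A a -> tri (F 0 a0) (F 0 a2) (F 0 a) = 0.
  move=> Aa.
  (* For [a4 = (1 + e) ^+ 2 * a0], the product required by [dependent_triple] is [a0 * (pol b).[e]],
     and [pol b] takes the value [(2 * (a0 + b)) ^+ 2] at 0. When [a0 + b = 0] the other alternative
     of that lemma applies, and 1 is a placeholder. *)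
  pose pol b : {poly k} := if a0 + b == 0 then 1 else
    (2 * (a0 + b))%:P * (1%:P + (1%:P + 'X) ^+ 2) * (b%:P + (1%:P + 'X) ^+ 2 * a0%:P).
  (* The excluded values are those for which [a4] is 0 or [a0]. *)
  have [|e] := @squares_open [:: pol a2; pol a] [:: 0; -1; - (2 : k)].
    have pol0 b : exists2 r, r != 0 & (pol b).[0] = r ^+ 2.
      rewrite /pol; case: eqP => [_|/eqP ab].
        by exists 1; rewrite ?oner_eq0 // hornerC expr1n.
      exists (2 * (a0 + b)); first by rewrite mulf_neq0.
      by rewrite !horner_ring; ring.
    by move=> p; rewrite !inE => /orP[] /eqP ->.
  rewrite !inE !negb_or => /and3P[e0 e1 e2] hpol.
  have e10 : 1 + e != 0 by rewrite addrC addr_eq0.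
  pose a4 := (1 + e) ^+ 2 * a0; have Aa4 : A a4 by apply: A_sq.
  have a04 : a0 - a4 != 0.
    have -> : a0 - a4 = - (e * (e + 2) * a0) by rewrite /a4; ring.
    by rewrite oppr_eq0 !mulf_neq0 // addr_eq0.
  have line b : A b -> pol b \in [:: pol a2; pol a] ->
      tri (F 0 a0) (F 0 a4) (F 0 b) = 0.
    move=> Ab /hpol[s s0 Es].
    rewrite -[LHS]opprK; have -> : - tri (F 0 a0) (F 0 a4) (F 0 b) =
      tri (F 0 a0) (F 0 b) (F 0 a4) by rewrite /tri; ring.
    apply/eqP; rewrite oppr_eq0; apply/eqP.
    apply: (@dependent_triple _ _ _ a0 b a4); do ?[exact: A_neq0|
      exact: preserves_dist_vert|exact: (Q_neq0 _ HF)];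
      first by case: HF => + _; apply.
    move: Es; rewrite /pol; case: eqP => [ab _|_ Es]; first by left.
    right; exists s => //; rewrite -Es !horner_ring /a4; ring.
  apply: (@tri_trans _ two0 (F 0 a0) (F 0 a4)); last 2 first.
  - by apply: line; rewrite // mem_head.
  - by apply: line; rewrite // !inE eqxx orbT.
  (* The invariant gives [(B ^+ 2 - 4 * (Q0 * Q4)) * (a0 * a4) = (a0 - a4) ^+ 2 * (Q0 * Q4)], hence
     the independence of [F 0 a0] and [F 0 a4]. *)
  have := preserves_dist_vert HF A_a0 Aa4.
  set B := Bf _ _; set Q0 := Qf _; set Q4 := Qf _ => E.
  apply/eqP => E4; move: E; rewrite E4 => E.
  have QQ : Q0 * Q4 != 0 by rewrite mulf_neq0 ?(Q_neq0 _ HF).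
  case/negP: (mulf_neq0 QQ (expf_neq0 2 a04)); apply/eqP.
  transitivity ((a0 + a4) ^+ 2 * (Q0 * Q4) - 4 * (Q0 * Q4) * (a0 * a4)).
    by ring.
  by rewrite -E subrr.
have Q00 := Q_neq0 0 HF A_a0; have Q20 := Q_neq0 0 HF Aa2.
have := preserves_dist_vert HF A_a0 Aa2; move: plane Q00 Q20.
set v := F 0 a0; set w := F 0 a2 => plane Q00 Q20 E.
have {}E : Bf v w ^+ 2 * c ^+ 2 = (1 + c ^+ 2) ^+ 2 * (Qf v * Qf w).
  apply: (mulIf (expf_neq0 2 a00)).
  transitivity (Bf v w ^+ 2 * (a0 * a2)); first by rewrite /a2; ring.
  by rewrite E /a2; ring.
have B0 : Bf v w != 0.
  apply: contraNneq (mulf_neq0 (expf_neq0 2 c2) (mulf_neq0 Q00 Q20)) => B0.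
  by rewrite -E B0 expr2 !mul0r.
(* The normal vector of the plane of [v] and [w]. Its discriminant is B^2 - 4 Q Q', which is a
   square because [a2 / a0 = c ^+ 2] is. *)
pose n0 := v 1 0 * w 2 0 - v 2 0 * w 1 0.
pose n1 := v 2 0 * w 0 0 - v 0 0 * w 2 0.
pose n2 := v 0 0 * w 1 0 - v 1 0 * w 0 0.
have [||p [q [r [s [d0 E0 E1 E2]]]]] := @factor_binary_form _ two0 n0 n1 n2
    (Bf v w * (1 - c ^+ 2) / (1 + c ^+ 2)).
- by rewrite mulf_neq0 ?invr_eq0 // mulf_neq0.
- transitivity (Bf v w ^+ 2 - 4 * (Qf v * Qf w)).
    by rewrite (BfE two0) /Qf /n0 /n1 /n2; ring.
  have -> : Qf v * Qf w = Bf v w ^+ 2 * c ^+ 2 / (1 + c ^+ 2) ^+ 2.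
    by rewrite E; field.
  by field.
exists p, q, r, s; split=> // a /plane Ea.
by rewrite -[RHS]Ea sym2E vec3E E0 E1 E2 /tri /n0 /n1 /n2; ring.
Qed.

(** The distances between two points [(x, 0, t * x)] leave two options, [t] proportional to [a] or
    to [1 / a]. One option holds for all [a] at once, and exchanging x and z reduces the second to
    the first. *)
Lemma normalize_vertical F : preserves_dist F ->
  (forall a, A a -> F 0 a 1 0 = 0) ->
  exists p q r s kappa, [/\ p * s - q * r != 0, kappa != 0 &
    forall a, A a -> let w := sym2 p q r s *m F 0 a in
      w 1 0 = 0 /\ w 2 0 = kappa * a * w 0 0].
Proof.
move=> HF y0.
have xz a : A a -> F 0 a 0 0 != 0 /\ F 0 a 2 0 != 0.
  move=> Aa; have := Q_neq0 0 HF Aa; rewrite /Qf y0 // expr2 mul0r subr0.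
  by rewrite mulf_eq0 negb_or => /andP.
pose t a := F 0 a 2 0 / F 0 a 0 0.
have tz a : A a -> F 0 a 2 0 = t a * F 0 a 0 0.
  by move=> /xz[x0 _]; rewrite /t divfK.
have t0 a : A a -> t a != 0.
  by move=> /xz[x0 z0]; rewrite mulf_neq0 ?invr_eq0.
have tt a a' : A a -> A a' -> t a * a' = t a' * a \/ t a * a = t a' * a'.
  move=> Aa Aa'; have := preserves_dist_vert HF Aa Aa'.
  rewrite (BfE two0) /Qf !y0 // !tz //.
  have [[x0 _] [x'0 _]] := (xz _ Aa, xz _ Aa').
  move: (F 0 a 0 0) (F 0 a' 0 0) x0 x'0 => x x' x0 x'0 E.
  have : (x * x') ^+ 2 * ((t a * a' - t a' * a) * (t a * a - t a' * a')) == 0.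
    apply/eqP; transitivity
      ((x * (t a' * x') + t a * x * x' - 2 * (0 * 0)) ^+ 2 * (a * a') -
       (a + a') ^+ 2 * ((x * (t a * x) - 0 ^+ 2) * (x' * (t a' * x') - 0 ^+ 2))).
      by ring.
    by rewrite E subrr.
  rewrite mulf_eq0 sqrf_eq0 !mulf_eq0 (negPf x0) (negPf x'0) /= !subr_eq0.
  by case/orP => /eqP; [left|right].
have a00 := A_neq0 A_a0; pose kappa := t a0 / a0.
have kappa0 : kappa != 0 by rewrite mulf_neq0 ?invr_eq0 ?t0.
have [dir|] := pselect (forall a, A a -> t a = kappa * a).
  exists 1, 0, 0, 1, kappa; split=> //; first by rewrite mulr1 mulr0 subr0 oner_eq0.
  move=> a Aa; rewrite /= sym2E !vec3E y0 // tz // dir //; split; ring.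
move=> /existsNP[a1 /not_implyP[Aa1 ta1]].
have t1 : t a1 * a1 = t a0 * a0.
  case: (tt _ _ Aa1 A_a0) => // E; case: ta1.
  by apply: (mulIf a00); rewrite E /kappa; field.
(* If [a] were of direct type with respect to both [a0] and [a1], then [a1] would be so with respect
   to [a0]. *)
have inv a : A a -> t a * a = t a0 * a0.
  move=> Aa; have a_0 := A_neq0 Aa.
  case: (tt _ _ Aa A_a0) => // E; case: (tt _ _ Aa1 Aa) => [E1|<-//].
  case: ta1; apply: (mulIf a_0); rewrite E1; apply: (mulIf a00).
  transitivity (t a * a0 * a1); first by ring.
  by rewrite E /kappa; field.
(* This similitude is (x, y, z) -> (z, -y, x). *)
exists 0, 1, (-1), 0, ((t a0 * a0)^-1); split.
- by rewrite mul0r mul1r sub0r opprK oner_eq0.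
- by rewrite invr_eq0 mulf_neq0 ?t0.
move=> a Aa; rewrite /= sym2E !vec3E y0 // tz // -(inv a Aa); split; first by ring.
by field; rewrite t0 // A_neq0.
Qed.

(** The Vandermonde determinant of three distinct points is non-zero. *)
Lemma quadratic_eq0 r0 r1 r2 x y z :
  x != y -> x != z -> y != z ->
  (forall t, t \in [:: x; y; z] -> r0 + r1 * t + r2 * t ^+ 2 = 0) ->
  [/\ r0 = 0, r1 = 0 & r2 = 0].
Proof.
move=> xy xz yz E.
have Ex := E x (mem_head _ _).
have Ey : r0 + r1 * y + r2 * y ^+ 2 = 0 by apply: E; rewrite !inE eqxx orbT.
have Ez : r0 + r1 * z + r2 * z ^+ 2 = 0 by apply: E; rewrite !inE eqxx !orbT.
rewrite -subr_eq0 in xy; rewrite -subr_eq0 in xz; rewrite -subr_eq0 in yz.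
have r20 : r2 = 0.
  apply: (mulfI (mulf_neq0 (mulf_neq0 xy xz) yz)); rewrite mulr0.
  transitivity ((r0 + r1 * x + r2 * x ^+ 2) * (y - z)
    - (r0 + r1 * y + r2 * y ^+ 2) * (x - z)
    + (r0 + r1 * z + r2 * z ^+ 2) * (x - y)); first by ring.
  by rewrite Ex Ey Ez; ring.
have r10 : r1 = 0.
  apply: (mulfI xy); rewrite mulr0.
  transitivity ((r0 + r1 * x + r2 * x ^+ 2) - (r0 + r1 * y + r2 * y ^+ 2)).
    by rewrite r20; ring.
  by rewrite Ex Ey subr0.
by split=> //; move: Ex; rewrite r10 r20 !mul0r !addr0.
Qed.

(* Equality of distances to [(0, a)] is an identity between two polynomials of
   degree 2 in [a]; it holds for infinitely many [a], namely whenever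
   [a = e^2 a0] is small. *)
Lemma coords_from_vertical F kappa : preserves_dist F -> kappa != 0 ->
  (forall a, A a -> F 0 a 1 0 = 0 /\ F 0 a 2 0 = kappa * a * F 0 a 0 0) ->
  forall u b, A b -> let w := F u b in
  [/\ w 0 0 != 0, w 2 0 = kappa * (u ^+ 2 + b) * w 0 0
    & w 1 0 ^+ 2 = kappa * (u * w 0 0) ^+ 2].
Proof.
move=> HF k0 vert u b Ab w.
have a00 := A_neq0 A_a0; have b0 := A_neq0 Ab.
pose c := u ^+ 2 + b.
have c0 : c != 0.
  apply: contraNneq (A_nsq Ab u) => E.
  by rewrite eq_sym -subr_eq0 opprK; apply/eqP.
have key a : A a -> coline 0 a u b ->
  b * (w 2 0 + kappa * a * w 0 0) ^+ 2 = kappa * Qf w * (c + a) ^+ 2.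
  move=> Aa cl; have a_0 := A_neq0 Aa.
  case: (HF) => _ /(_ _ _ _ _ Aa Ab cl); rewrite (BfE two0) {1}/Qf -/w.
  have [-> ->] := vert a Aa => E.
  have x0 : F 0 a 0 0 != 0.
    apply: contraNneq (Q_neq0 0 HF Aa) => x0.
    by rewrite /Qf x0; have [-> _] := vert a Aa; apply/eqP; ring.
  apply: (mulfI (mulf_neq0 a_0 (expf_neq0 2 x0))).
  move: E; rewrite sub0r sqrrN /c => E.
  transitivity ((F 0 a 0 0 * w 2 0 + kappa * a * F 0 a 0 0 * w 0 0 -
     2 * (0 * w 1 0)) ^+ 2 * (a * b)); first by ring.
  by rewrite E; ring.
(* The discriminant in [coline 0 a u b] for [a = X ^+ 2 * a0]; its value at 0 is the non-zero square
   [c ^+ 2]. *)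
pose p : {poly k} := (c%:P + a0%:P * 'X^2) ^+ 2 - (4 * (a0 * b))%:P * 'X^2.
have pick bad : exists2 e, e \notin 0 :: bad & coline 0 (e ^+ 2 * a0) u b.
  have [|e ebad hp] := @squares_open [:: p] (0 :: bad).
    move=> _ /[!inE] /eqP ->; exists c => //.
    by rewrite /p !horner_ring; ring.
  exists e => //; have [s s0 Es] := hp p (mem_head _ _).
  exists s => //; rewrite -Es /p !horner_ring /c; ring.
(* Opposites are excluded as well, since only the squares of [e1], [e2], [e3] matter. *)
have [e1] := pick [::]; rewrite inE => e10 cl1.
have [e2] := pick [:: e1; - e1]; rewrite !inE !negb_or => /and3P[e20 e21 e2N1] cl2.
have [e3] := pick [:: e1; - e1; e2; - e2].
rewrite !inE !negb_or => /and5P[e30 e31 e3N1 e32 e3N2] cl3.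
have neq e e' : e' != e -> e' != - e -> e ^+ 2 * a0 != e' ^+ 2 * a0.
  move=> h1 h2; apply/eqP => /(mulIf a00) /eqP.
  by rewrite eq_sym eqf_sqr (negPf h1) (negPf h2).
(* The coefficients of [key] in [a]. The quadratic one yields [Qf w], the linear one then yields
   [w 2 0], and the formula for [Qf] yields [w 1 0 ^+ 2]. *)
have [||||E0 E1 E2] := @quadratic_eq0
  (b * w 2 0 ^+ 2 - kappa * Qf w * c ^+ 2)
  (2 * (kappa * (b * w 2 0 * w 0 0 - Qf w * c)))
  (kappa * (b * kappa * w 0 0 ^+ 2 - Qf w))
  (e1 ^+ 2 * a0) (e2 ^+ 2 * a0) (e3 ^+ 2 * a0); do ?[exact: neq].
  move=> a ha; have {ha} [Aa cl] : A a /\ coline 0 a u b.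
    by move: ha; rewrite !inE => /or3P[] /eqP ->; split=> //; apply: A_sq.
  transitivity (b * (w 2 0 + kappa * a * w 0 0) ^+ 2
                - kappa * Qf w * (c + a) ^+ 2); first by ring.
  by rewrite key // subrr.
have {}E2 : Qf w = b * kappa * w 0 0 ^+ 2.
  by apply/eqP; rewrite eq_sym -subr_eq0; apply/eqP/(mulfI k0); rewrite E2 mulr0.
have x0 : w 0 0 != 0.
  apply: contraNneq (Q_neq0 u HF Ab) => x0.
  by rewrite -/w E2 x0; apply/eqP; ring.
have z : w 2 0 = kappa * c * w 0 0.
  apply: (mulIf x0); apply: (mulfI b0); apply: (mulfI k0); apply: (mulfI two0).
  apply/eqP; rewrite -subr_eq0; apply/eqP; rewrite -E1 E2; ring.
split=> //; apply/eqP; rewrite -subr_eq0 -oppr_eq0; apply/eqP.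
transitivity (Qf w - b * kappa * w 0 0 ^+ 2); last by rewrite E2 subrr.
by rewrite /Qf z /c; ring.
Qed.

(** At the point (1, [a0]) the relation y^2 = [kappa] x^2 provides a square root [l] of [kappa]. The
    diagonal matrix with entries [l], 1 removes [kappa], and taking [l = y / x] fixes the sign at
    this point. *)
Lemma normalize_frame F kappa : preserves_dist F -> kappa != 0 ->
  (forall a, A a -> F 0 a 1 0 = 0 /\ F 0 a 2 0 = kappa * a * F 0 a 0 0) ->
  exists p q r s, [/\ p * s - q * r != 0,
    forall a, A a -> let w := sym2 p q r s *m F 0 a in
      w 1 0 = 0 /\ w 2 0 = 1 * a * w 0 0 &
    exists c, sym2 p q r s *m F 1 a0 = c *: std 1 a0].
Proof.
move=> HF k0 vert.
have [x0 z y] := coords_from_vertical HF k0 vert 1 A_a0.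
pose l := F 1 a0 1 0 / F 1 a0 0 0.
have l2 : l ^+ 2 = kappa.
  by rewrite expr_div_n y; field.
have l0 : l != 0 by rewrite -sqrf_eq0 l2.
have yl : F 1 a0 1 0 = l * F 1 a0 0 0 by rewrite divfK.
exists l, 0, 0, 1; split.
- by rewrite mulr1 mulr0 subr0.
- move=> a Aa; have [y0 z0] := vert a Aa.
  by rewrite /= sym2E !vec3E y0 z0 -l2; split; ring.
- exists (l ^+ 2 * F 1 a0 0 0); apply: col3P;
  by rewrite sym2E !mxE /= z yl -l2; ring.
Qed.

(** Each image is [std u b] or [std (- u) b] up to scaling. The correct sign passes from (1, [a0])
    to (1, [b1]) with [b1] small, and from there to any [(u, b)]. *)
Lemma framed_identity F : preserves_dist F ->
  (forall a, A a -> F 0 a 1 0 = 0 /\ F 0 a 2 0 = 1 * a * F 0 a 0 0) ->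
  (exists c, F 1 a0 = c *: std 1 a0) ->
  forall u b, A b -> exists c, F u b = c *: std u b.
Proof.
move=> HF vert F1 u b Ab.
have coords u1 b1 : A b1 -> exists c, c != 0 /\
    (F u1 b1 = c *: std u1 b1 \/ F u1 b1 = c *: std (- u1) b1).
  move=> Ab1; have [x0 z /eqP] := coords_from_vertical HF (oner_neq0 _) vert u1 Ab1.
  rewrite mul1r eqf_sqr => y; exists (F u1 b1 0 0); split=> //.
  by case/orP: y => /eqP y; [left|right];
    apply: col3P; rewrite !mxE /= ?z ?y ?mxE /=; ring.
have spread u1 b1 u2 b2 : A b1 -> A b2 -> coline u1 b1 u2 b2 ->
    u1 != 0 -> u1 ^+ 2 + u2 ^+ 2 + b1 + b2 != 0 ->
    (exists c, F u1 b1 = c *: std u1 b1) -> exists c, F u2 b2 = c *: std u2 b2.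
  move=> Ab1 Ab2 cl u10 s0 [c1 E1].
  have [c2 [c20 [E2|E2]]] := coords u2 _ Ab2; first by exists c2.
  have [u20|u20] := eqVneq u2 0.
    by exists c2; rewrite E2 u20 oppr0.
  case: (HF) => _ /(_ _ _ _ _ Ab1 Ab2 cl).
  rewrite E1 E2 (BfZl two0) (BfZr two0) !QfZ !Qf_std (Bf_std two0) => E.
  have c10 : c1 != 0.
    apply: contraNneq (Q_neq0 u1 HF Ab1) => c10.
    by rewrite E1 c10 QfZ; apply/eqP; ring.
  have four0 : (4 : k) != 0 by rewrite (natrM _ 2 2) mulf_neq0.
  (* With the wrong sign at [u2], the squares of [(u1 + u2) ^+ 2 + b1 + b2] and
     [(u1 - u2) ^+ 2 + b1 + b2] agree; this product is their difference. *)
  have : 2 * 4 * (u1 * u2 * (u1 ^+ 2 + u2 ^+ 2 + b1 + b2)) == 0.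
    rewrite -(mulrI_eq0 _ (mulfI (mulf_neq0 (expf_neq0 2 (mulf_neq0 c10 c20))
      (mulf_neq0 (A_neq0 Ab1) (A_neq0 Ab2))))) -subr_eq0 subr0; apply/eqP.
    transitivity ((c1 * (c2 * ((u1 - - u2) ^+ 2 + b1 + b2))) ^+ 2 * (b1 * b2) -
      ((u1 - u2) ^+ 2 + b1 + b2) ^+ 2 * (c1 ^+ 2 * b1 * (c2 ^+ 2 * b2))).
      by ring.
    by rewrite E subrr.
  by rewrite !mulf_eq0 (negPf two0) (negPf four0) (negPf u10) (negPf u20)
    (negPf s0).
have a00 := A_neq0 A_a0.
(* [l1] and [l2] contain the [e] for which the sum that [spread] requires to be non-zero vanishes,
   in the first and the second transfer. *)
have [l1 l1P] := square_roots_seq (- (1 ^+ 2 + 1 ^+ 2 + a0) / a0).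
have [l2 l2P] := square_roots_seq (- (1 ^+ 2 + u ^+ 2 + b) / a0).
pose pol u' b' : {poly k} :=
  (((1 - u') ^+ 2 + b')%:P + a0%:P * 'X^2) ^+ 2 - (4 * (a0 * b'))%:P * 'X^2.
have [|e] := @squares_open [:: pol 1 a0; pol u b] (0 :: l1 ++ l2).
  have pol0 u' b' : A b' -> exists2 r, r != 0 & (pol u' b').[0] = r ^+ 2.
    move=> Ab'; exists ((1 - u') ^+ 2 + b').
      apply: contraNneq (A_nsq Ab' (1 - u')) => E.
      by rewrite eq_sym -subr_eq0 opprK; apply/eqP.
    by rewrite /pol !horner_ring; ring.
  by move=> p; rewrite !inE => /orP[] /eqP ->; apply: pol0.
rewrite inE mem_cat !negb_or => /and3P[e0 el1 el2] hpol.
pose b1 := e ^+ 2 * a0; have Ab1 : A b1 by apply: A_sq.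
have cl u' b' : pol u' b' \in [:: pol 1 a0; pol u b] -> coline 1 b1 u' b'.
  move=> /hpol[s s0 Es]; exists s => //.
  by rewrite -Es /pol !horner_ring /b1; ring.
have clC : coline 1 a0 1 b1.
  have [|s s0 Es] := cl 1 a0; first by rewrite mem_head.
  by exists s => //; rewrite -Es; ring.
apply: (spread 1 b1) => //.
- by apply: cl; rewrite !inE eqxx orbT.
- exact: oner_neq0.
- apply: contraNneq el2 => E; apply: l2P.
  apply: (mulIf a00); rewrite mulrVK ?unitfE //; apply/eqP.
  by rewrite -subr_eq0 opprK; apply/eqP; rewrite -E /b1; ring.
apply: (spread 1 a0) => //.
- exact: oner_neq0.
- apply: contraNneq el1 => E; apply: l1P.
  apply: (mulIf a00); rewrite mulrVK ?unitfE //; apply/eqP.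
  by rewrite -subr_eq0 opprK; apply/eqP; rewrite -E /b1; ring.
Qed.

(** By [sym2M] the three normalizations compose to a single [sym2], whose determinant is the product
    of theirs. *)
Lemma rigidity F : preserves_dist F ->
  exists p q r s, p * s - q * r != 0 /\
    forall u a, A a -> exists c, sym2 p q r s *m F u a = c *: std u a.
Proof.
move=> H0.
have [p1 [q1 [r1 [s1 [d1 y1]]]]] := straighten_vertical H0.
have H1 := preserves_dist_sym2 d1 H0.
have [p2 [q2 [r2 [s2 [ka [d2 k0 v2]]]]]] := normalize_vertical H1 y1.
have H2 := preserves_dist_sym2 d2 H1.
have [p3 [q3 [r3 [s3 [d3 v3 f3]]]]] := normalize_frame H2 k0 v2.
have H3 := preserves_dist_sym2 d3 H2.
have := framed_identity H3 v3 f3.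
have E x := etrans
  (congr1 (mulmx (sym2 p3 q3 r3 s3)) (sym2M p2 q2 r2 s2 p1 q1 r1 s1 x))
  (sym2M p3 q3 r3 s3 _ _ _ _ x).
move=> id; do 4 eexists; split; last first.
  by move=> u a /(id u)[c]; rewrite E => Ec; exists c; exact: Ec.
rewrite [X in X != 0](_ : _ =
  (p3 * s3 - q3 * r3) * (p2 * s2 - q2 * r2) * (p1 * s1 - q1 * r1)); last by ring.
by rewrite !mulf_neq0.
Qed.

End Rigidity.

(** * Points, long lines and distances in coordinates *)

Section Transfer.
Variable k : fieldType.
Hypothesis k_local : nonarch_local_field k.
Hypothesis two0 : (2 : k) != 0.
Variable abar : set k.
Hypothesis abar_class : square_class abar.
Hypothesis abarN1 : ~ abar (- 1).
Implicit Types (v w : 'cV[k]_3) (p : set 'cV[k]_3) (u a : k).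

(** * The norm group [K_ abar] and its orbits *)

Local Notation K := (K_ abar).

(** [K_] asks for both [x] and [y] to be non-zero. If one of them is 0, the value is multiplied by 1
    = a X^2 + Y^2 with X and Y non-zero. *)
Lemma K_intro (a x y : k) : abar a -> a * x ^+ 2 + y ^+ 2 != 0 ->
  K (a * x ^+ 2 + y ^+ 2).
Proof.
case: abar_class => a1 a10 Eabar aa t0.
have abarM b z : abar b -> z != 0 -> abar (b * z ^+ 2).
  rewrite Eabar => -[x1 x10 <-] z0; exists (x1 * z); last by ring.
  by rewrite /= mulf_neq0.
have a0 : a != 0.
  by move: aa; rewrite Eabar => -[x1 x10 <-]; rewrite mulf_neq0 ?expf_neq0.
have [l lP] := square_roots_seq a^-1.
have [m mbad _] : exists2 m, m \notin (0 :: l) &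
    forall p : {poly k}, p \in [::] -> exists2 s, s != 0 & p.[m] = s ^+ 2.
  exact: square_near_all.
move: mbad; rewrite inE negb_or => /andP[m0 ml].
have h1 : 1 + a * m ^+ 2 != 0.
  apply/eqP => /eqP; rewrite addrC addr_eq0 => /eqP E; apply: abarN1.
  by rewrite -E; apply: abarM.
have h2 : 1 - a * m ^+ 2 != 0.
  apply: contra ml; rewrite subr_eq0 => /eqP E; apply: lP.
  by apply: (mulfI a0); rewrite -E mulfV.
(* The rational parametrization of the conic a X^2 + Y^2 = 1. *)
pose X := 2 * m / (1 + a * m ^+ 2); pose Y := (1 - a * m ^+ 2) / (1 + a * m ^+ 2).
have XY : a * X ^+ 2 + Y ^+ 2 = 1 by rewrite /X /Y; field.
have X0 : X != 0 by rewrite /X mulf_neq0 ?invr_eq0 ?mulf_neq0.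
have Y0 : Y != 0 by rewrite /Y mulf_neq0 ?invr_eq0.
split=> //; exists a.
have [x0|x0] := eqVneq x 0.
  have y0 : y != 0.
    by apply: contraNneq t0 => y0; rewrite x0 y0; apply/eqP; ring.
  exists (X * y), (Y * y); split=> //; do ?[exact: mulf_neq0].
  transitivity (1 * y ^+ 2); first by rewrite x0; ring.
  by rewrite -XY; ring.
have [y0|y0] := eqVneq y 0; last by exists x, y.
exists (x * Y), (a * x * X); split=> //;
  do ?[exact: mulf_neq0|exact: (mulf_neq0 (mulf_neq0 a0 x0) X0)].
transitivity (a * x ^+ 2 * 1); first by rewrite y0; ring.
by rewrite -XY; ring.
Qed.

(** A non-trivial zero would give -1 = a (x / y)^2, an element of [abar]. *)
Lemma norm_form_neq0 (a x y : k) : abar a -> (x != 0) || (y != 0) ->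
  a * x ^+ 2 + y ^+ 2 != 0.
Proof.
case: abar_class => a1 a10 Eabar aa.
have a0 : a != 0.
  by move: aa; rewrite Eabar => -[x1 x10 <-]; rewrite mulf_neq0 ?expf_neq0.
have [->|y0 _] := eqVneq y 0.
  rewrite orbF => x0; rewrite [0 ^+ 2]expr2 mulr0 addr0.
  by rewrite mulf_neq0 ?expf_neq0.
apply/eqP => E; have x0 : x != 0.
  apply: contraNneq (expf_neq0 2 y0) => x0.
  by rewrite -E x0; apply/eqP; ring.
apply: abarN1; move: aa; rewrite Eabar => -[x1 x10 Ea].
exists (x1 * x / y); first by rewrite /= !mulf_neq0 ?invr_eq0.
apply: (mulIf (expf_neq0 2 y0)).
transitivity (a1 * x1 ^+ 2 * x ^+ 2); first by field.
by rewrite Ea; apply/eqP; rewrite -subr_eq0; apply/eqP; rewrite -E; ring.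
Qed.

Lemma K_norm (a x y : k) : abar a -> (x != 0) || (y != 0) ->
  K (a * x ^+ 2 + y ^+ 2).
Proof. by move=> aa xy; apply/K_intro/norm_form_neq0. Qed.

Lemma abar_mem : exists a, abar a.
Proof.
case: abar_class => a a0 ->; exists (a * 1 ^+ 2), 1 => //=.
exact: oner_neq0.
Qed.

Lemma K_sqr x : x != 0 -> K (x ^+ 2).
Proof.
have [a aa] := abar_mem => x0.
by have := @K_norm a 0 x aa; rewrite x0 orbT [0 ^+ 2]expr2 !mulr0 add0r; apply.
Qed.

Lemma K_neq0 t : K t -> t != 0.
Proof. by case. Qed.

(** Multiplicativity of the norm form b x^2 + y^2 (Brahmagupta's identity). *)
Lemma K_mul t t' : K t -> K t' -> K (t * t').
Proof.
move=> [t0 [b [x [y [ab x0 y0 Et]]]]] [t'0 [b' [x' [y' [ab' x'0 y'0 Et']]]]].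
have [a1 a10 Eabar] := abar_class.
have [z Ez] : exists z, b' = b * z ^+ 2.
  move: ab ab'; rewrite Eabar => -[x1 x10 <-] [x2 _ <-].
  by exists (x2 / x1); field; rewrite x10.
have E : t * t' = b * (x * y' + z * x' * y) ^+ 2 + (y * y' - b * x * (z * x')) ^+ 2.
  by rewrite Et Et' Ez; ring.
by rewrite E; apply: K_intro => //; rewrite -E mulf_neq0.
Qed.

Lemma K_inv t : K t -> K t^-1.
Proof.
move=> Kt; have t0 := K_neq0 Kt.
have -> : t^-1 = t * (t^-1) ^+ 2 by field.
by apply: K_mul => //; apply: K_sqr; rewrite invr_eq0.
Qed.

Lemma K_1 : K 1.
Proof. by rewrite -[1](expr1n _ 2); apply/K_sqr/oner_neq0. Qed.

Lemma orbit_self v : orbit_K abar v v.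
Proof. by exists 1; [exact: K_1|rewrite scale1r]. Qed.

Lemma orbit_scale c v : K c -> orbit_K abar (c *: v) = orbit_K abar v.
Proof.
move=> Kc; apply/seteqP; split=> _ [d Kd <-].
  by exists (d * c); [exact: K_mul|rewrite scalerA].
exists (d * c^-1); first by apply/K_mul/K_inv.
by rewrite scalerA divfK // K_neq0.
Qed.

Lemma orbit_eq v w : orbit_K abar v = orbit_K abar w -> exists2 c, K c & w = c *: v.
Proof.
by move=> E; have := orbit_self w; rewrite -E => -[c Kc <-]; exists c.
Qed.

(* These are the values of [Q] at the vectors of [H_ abar] with first
   coordinate 1. *)
Definition Kdef a : Prop :=
  forall s t, (s != 0) || (t != 0) -> K (t ^+ 2 + a * s ^+ 2).

Lemma Kdef_nsq a : Kdef a -> forall s, - a != s ^+ 2.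
Proof.
move=> Aa s; apply/eqP => E.
have /K_neq0/eqP[] : K (s ^+ 2 + a * 1 ^+ 2) by apply: Aa; rewrite oner_neq0.
by rewrite -E; ring.
Qed.

Lemma Kdef_sq (c : k) a : c != 0 -> Kdef a -> Kdef (c ^+ 2 * a).
Proof.
move=> c0 Aa s t st.
have -> : t ^+ 2 + c ^+ 2 * a * s ^+ 2 = t ^+ 2 + a * (c * s) ^+ 2 by ring.
by apply: Aa; rewrite mulf_eq0 (negPf c0).
Qed.

Lemma Kdef_abar a : abar a -> Kdef a.
Proof. by move=> aa s t st; rewrite addrC; apply: K_norm. Qed.

(* In [C1], the condition [w != 0] is about the coefficient function of [w]. *)
Lemma C1P w : C1 w <-> [/\ w != 0, w 0 0 * w 2 0 = w 1 0 ^+ 2,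
  exists s, w 0 0 = s ^+ 2 & exists t, w 2 0 = t ^+ 2].
Proof.
split=> -[w0 E s t]; split=> //; apply: contra w0 => /eqP w0; apply/eqP.
  by rewrite w0; apply/funext => i; apply/funext => j; rewrite mxE.
by apply/matrixP => i j; rewrite w0 mxE.
Qed.

Lemma C1_param (s t : k) : (s != 0) || (t != 0) -> C1 (vec3 (s ^+ 2) (s * t) (t ^+ 2)).
Proof.
move=> st; apply/C1P; split; rewrite ?vec3E; [|by ring|by exists s|by exists t].
apply/eqP => /matrixP E; move: st; rewrite -(sqrf_eq0 s) -(sqrf_eq0 t).
by have := E 0 0; have := E 2 0; rewrite !vec3E !mxE => -> ->; rewrite eqxx.
Qed.

(** The square roots [s] and [t] give [w 1 0] only up to sign, which is absorbed in [t]. *)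
Lemma C1_inv w : C1 w ->
  exists s t, (s != 0) || (t != 0) /\ w = vec3 (s ^+ 2) (s * t) (t ^+ 2).
Proof.
case/C1P=> w0 E [s Es] [t Et].
have {}E : (w 1 0 == s * t) || (w 1 0 == s * - t).
  by rewrite mulrN -eqf_sqr -E Es Et exprMn.
have [t' Et' E'] : exists2 t', w 2 0 = t' ^+ 2 & w 1 0 = s * t'.
  by case/orP: E => /eqP; [exists t|exists (- t)]; rewrite ?sqrrN.
exists s, t'; split; last by rewrite (vec3_eta w) Es Et' E'.
have := col3_neq0 w0; rewrite Es Et' E'.
apply: contraTT; rewrite !negb_or !negbK => /andP[/eqP-> /eqP->].
by rewrite mulr0 expr2 mulr0 eqxx.
Qed.

Lemma H_std u a : Kdef a -> H_ abar (std u a).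
Proof.
move=> Aa w /C1_inv[s [t [st ->]]]; rewrite (BfE two0) !vec3E.
have -> : 1 * t ^+ 2 + (u ^+ 2 + a) * s ^+ 2 - 2 * (u * (s * t)) =
  (t - u * s) ^+ 2 + a * s ^+ 2 by ring.
apply: Aa; move: st; have [->|//] := eqVneq s 0.
by rewrite mulr0 subr0.
Qed.

Lemma H_first v : H_ abar v -> K (v 0 0).
Proof.
move=> /(_ (vec3 (0 ^+ 2) (0 * 1) (1 ^+ 2))).
rewrite (BfE two0) !vec3E.
have -> : v 0 0 * 1 ^+ 2 + v 2 0 * 0 ^+ 2 - 2 * (v 1 0 * (0 * 1)) = v 0 0 by ring.
by apply; apply: C1_param; rewrite oner_neq0 orbT.
Qed.

Lemma H_inv v : H_ abar v ->
  exists u a, Kdef a /\ v = v 0 0 *: std u a.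
Proof.
move=> Hv; have Kx := H_first Hv; have x0 := K_neq0 Kx.
pose u := v 1 0 / v 0 0; pose a := v 2 0 / v 0 0 - u ^+ 2.
exists u, a; split; last first.
  by apply: col3P; rewrite !mxE /= /a /u; field.
move=> s t st.
(* The shift by [u * s] undoes the completed square in the pairing with [std u a]. *)
have := Hv (vec3 (s ^+ 2) (s * (t + u * s)) ((t + u * s) ^+ 2)).
rewrite (BfE two0) !vec3E => KB.
have -> : t ^+ 2 + a * s ^+ 2 = (v 0 0)^-1 * (v 0 0 * (t + u * s) ^+ 2 +
    v 2 0 * s ^+ 2 - 2 * (v 1 0 * (s * (t + u * s)))).
  by rewrite /a /u; field.
apply: K_mul; first exact: K_inv.
apply: KB; apply: C1_param; move: st; have [->|//] := eqVneq s 0.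
by rewrite mulr0 addr0.
Qed.

Definition pt u a := orbit_K abar (std u a).

Lemma D_pt u a : Kdef a -> D_ abar (pt u a).
Proof. by move=> Aa; exists (std u a) => //; apply: H_std. Qed.

Lemma D_inv p : D_ abar p -> exists u a, Kdef a /\ p = pt u a.
Proof.
move=> [v Hv <-]; have [u [a [Aa Ev]]] := H_inv Hv.
by exists u, a; split=> //; rewrite Ev orbit_scale //; apply: H_first.
Qed.

(** Scaling by a non-zero end coordinate makes both ends squares: if xz = y^2 then x (x, y, z) =
    (x^2, xy, y^2). *)
Lemma isotropic_C1 w : w != 0 -> Qf w = 0 -> exists2 c, c != 0 & C1 (c *: w).
Proof.
move=> w0; rewrite /Qf => /eqP; rewrite subr_eq0 => /eqP E.
have [x0|x0] := eqVneq (w 0 0) 0.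
  have y0 : w 1 0 = 0 by apply/eqP; rewrite -sqrf_eq0 -E x0 mul0r.
  have z0 : w 2 0 != 0.
    by have := col3_neq0 w0; rewrite x0 y0 eqxx.
  exists (w 2 0) => //; have -> : w 2 0 *: w =
    vec3 (0 ^+ 2) (0 * w 2 0) (w 2 0 ^+ 2).
    by apply: col3P; rewrite !mxE /= ?x0 ?y0; ring.
  by apply: C1_param; rewrite z0 orbT.
exists (w 0 0) => //; have -> : w 0 0 *: w =
  vec3 (w 0 0 ^+ 2) (w 0 0 * w 1 0) (w 1 0 ^+ 2).
  by apply: col3P; rewrite !mxE /= -?E; ring.
by apply: C1_param; rewrite x0.
Qed.

(** * Long lines and the multiplicative distance *)

Lemma std_neq0 u a : std u a != 0.
Proof.
apply/eqP => /matrixP/(_ 0 0); rewrite vec3E mxE.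
by apply/eqP/oner_neq0.
Qed.

Lemma dim_span2 v w : v != 0 -> (forall c, w <> c *: v) ->
  \dim <<[:: w; v]>>%VS = 2%N.
Proof.
move=> v0 wv; apply/eqP; have : free [:: w; v].
  rewrite free_cons seq1_free v0 andbT span_seq1.
  by apply/vlineP => -[c /wv].
by rewrite /free.
Qed.

Lemma mem_span2P v w x :
  reflect (exists c d, x = c *: v + d *: w) (x \in <<[:: v; w]>>%VS).
Proof.
rewrite span_cons span_seq1; apply: (iffP memv_addP).
  by move=> [_ /vlineP[c ->] [_ /vlineP[d ->] ->]]; exists c, d.
move=> [c [d ->]]; exists (c *: v); first by rewrite memvZ ?memv_line.
by exists (d *: w); rewrite ?memvZ ?memv_line.
Qed.

(** The plane of the two vectors contains two independent isotropic vectors, which scale into [C1].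
    Non-emptiness of the distance matters: an element of it is needed to compare invariants. *)
Lemma coline_long_line u a u' a' : Kdef a -> Kdef a' -> coline u a u' a' ->
  [/\ pt u a <> pt u' a', on_long_line abar (pt u a) (pt u' a') &
      mult_dist abar (pt u a) (pt u' a') !=set0].
Proof.
move=> Aa Aa' [r r0 Er].
have a0 : a != 0 := neq0_of_nsq (Kdef_nsq Aa).
set v := std u a; set v' := std u' a'; pose b := Bf v v'.
have Qv : Qf v = a by rewrite Qf_std.
have Qv' : Qf v' = a' by rewrite Qf_std.
have {}Er : b ^+ 2 - 4 * (a * a') = r ^+ 2 by rewrite -Er /b (Bf_std two0).
have r20 : r ^+ 2 != 0 by rewrite expf_neq0.
have vv' c : v <> c *: v'.
  move=> E; case/negP: r20; apply/eqP; rewrite -Er.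
  transitivity (b ^+ 2 - 4 * (Qf v * Qf v')); first by rewrite Qv Qv'.
  by rewrite /b E (BfE two0) /Qf !mxE; ring.
have dist : pt u a <> pt u' a'.
  by move=> E; have [c _ /vv'] := orbit_eq (esym E).
pose P := <<[:: v; v']>>%VS.
have dimP : \dim P = 2%N by apply: dim_span2; rewrite ?std_neq0.
(* For [e = r] and [e = - r], the quadratic formula for the zeros of [Qf] on [P]. *)
pose n (e : k) := (e - b) *: v + (2 * a) *: v'.
have Qn e : e ^+ 2 = r ^+ 2 -> Qf (n e) = 0.
  move=> Ee; rewrite (Qf_comb two0) Qv Qv' -/b.
  transitivity (a * (e ^+ 2 - (b ^+ 2 - 4 * (a * a')))); first by ring.
  by rewrite Er Ee subrr mulr0.
have nP e : n e \in P by apply/mem_span2P; exists (e - b), (2 * a).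
(* This shows both that the isotropic vectors are non-zero and that they are not proportional. *)
have Bn : Bf (n r) (n (- r)) != 0.
  have -> : Bf (n r) (n (- r)) = - (2 * 2 * a * r ^+ 2).
    rewrite (Bf_comb two0) Qv Qv' -/b; transitivity
      (- (2 * a * (r ^+ 2 + (b ^+ 2 - 4 * (a * a'))))); first by ring.
    by rewrite Er; ring.
  by rewrite oppr_eq0 !mulf_neq0.
have n1 : n r != 0.
  apply: contraNneq Bn => ->; rewrite (BfE two0) !mxE; apply/eqP; ring.
have n2 : n (- r) != 0.
  apply: contraNneq Bn => ->; rewrite (BfE two0) !mxE; apply/eqP; ring.
have [c1 c10 C1w] := isotropic_C1 n1 (Qn r erefl).
have [c2 c20 C1w'] := isotropic_C1 n2 (Qn (- r) (sqrrN r)).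
have isoP : isotropic_plane P.
  by split=> //; exists (n r); split=> //; apply: Qn.
have inP x : x \in P -> x != 0 -> plane_image abar P (orbit_K abar x).
  by move=> xP x0; exists x.
have lineP : long_line_of abar P (D_ abar `&` plane_image abar P).
  split=> //; exists (pt u a); split; first exact: D_pt.
  by apply: inP; rewrite ?std_neq0 // memv_span ?mem_head.
have [Lp Lp'] : (D_ abar `&` plane_image abar P) (pt u a) /\
                (D_ abar `&` plane_image abar P) (pt u' a').
  split; (split; first exact: D_pt); apply: inP; rewrite ?std_neq0 //.
    by rewrite memv_span ?mem_head.
  by rewrite memv_span // !inE eqxx orbT.
split=> //; first by exists (D_ abar `&` plane_image abar P); split=> //; exists P.
exists (cross_ratio (c1 *: n r) (c2 *: n (- r)) v v').
exists P, (D_ abar `&` plane_image abar P), (c1 *: n r), (c2 *: n (- r)), v, v'.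
split=> //; last by split=> //; left.
- by split=> //; apply: inP; [rewrite memvZ|case/C1P: C1w].
- by split=> //; apply: inP; [rewrite memvZ|case/C1P: C1w'].
move=> /orbit_eq[c _ E]; case/negP: (mulf_neq0 c20 Bn); apply/eqP.
rewrite -(BfZr two0) E !(BfZr two0) -(Bf_diag two0) Qn //; ring.
Qed.

(** The factor [d] is a ratio of squares, hence a square, hence in [K]. So distinct points of the
    image of [C1] have independent representatives. *)
Lemma C1_proportional w d : C1 w -> C1 (d *: w) ->
  orbit_K abar w = orbit_K abar (d *: w).
Proof.
move=> C1w /C1P[dw0 _ [s' Es'] [t' Et']].
have d0 : d != 0 by apply: contraNneq dw0 => ->; rewrite scale0r.
suff [e Ee] : exists e, d = e ^+ 2.
  by rewrite orbit_scale // Ee; apply: K_sqr; rewrite -sqrf_eq0 -Ee.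
have [s [t [st Ew]]] := C1_inv C1w; move: Es' Et'; rewrite Ew !mxE /=.
have [s0|s0] := eqVneq s 0; last first.
  by move=> E _; exists (s' / s); rewrite expr_div_n -E; field.
move: st; rewrite s0 eqxx /= => t0 _ E.
by exists (t' / t); rewrite expr_div_n -E; field.
Qed.

(** In the isotropic basis [w], [w'], with v = l w + m w' and v' = l' w + m' w', the number [t] is l
    m' / (m l') or its inverse, Q(v) = l m e and B(v, v') = (l m' + m l') e. The scalars relating v,
    v' to the standard representatives cancel. *)
Lemma mult_dist_invariant u a u' a' t : Kdef a -> Kdef a' ->
  mult_dist abar (pt u a) (pt u' a') t ->
  t != 0 /\
  (t + 1) ^+ 2 * (a * a') = t * Bf (std u a) (std u' a') ^+ 2.
Proof.
move=> Aa Aa' [P [L [w [w' [v [v' [[[[dimP _] EL _] [Lp Lp']]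
  [C1w Pw] [C1w' Pw'] ww' [[Ev Ev'] Ht]]]]]]]].
have inP x : plane_image abar P (orbit_K abar x) -> x \in P.
  by move=> [y [yP y0] /orbit_eq[c _ ->]]; rewrite memvZ.
have {}Pw := inP _ Pw; have {}Pw' := inP _ Pw'.
have vP : v \in P by apply: inP; move: Lp; rewrite EL Ev => -[].
have v'P : v' \in P by apply: inP; move: Lp'; rewrite EL Ev' => -[].
have EP : P = <<[:: w; w']>>%VS.
  apply/esym/eqP; rewrite eqEdim; apply/andP; split.
    by apply/span_subvP => x; rewrite !inE => /orP[] /eqP ->.
  rewrite dimP dim_span2 //; first by case/C1P: C1w'.
  move=> c E; apply: ww'; apply/esym; rewrite E; apply: C1_proportional => //.
  by rewrite -E.
have Q0 (x : 'cV[k]_3) : C1 x -> Qf x = 0 by move=> /C1P[_ E _ _]; rewrite /Qf E subrr.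
move: vP v'P; rewrite EP => /mem_span2P[l [m Elm]] /mem_span2P[l' [m' Elm']].
have [e Ee] : exists e, Bf w w' = e by exists (Bf w w').
have [c Kc Ec] := orbit_eq Ev; have [c' Kc' Ec'] := orbit_eq Ev'.
have c0 := K_neq0 Kc; have c'0 := K_neq0 Kc'.
have Qv : c ^+ 2 * a = l * m * e.
  rewrite -(Qf_std u a) -QfZ -Ec Elm (Qf_comb two0) !Q0 // Ee; ring.
have Qv' : c' ^+ 2 * a' = l' * m' * e.
  rewrite -(Qf_std u' a') -QfZ -Ec' Elm' (Qf_comb two0) !Q0 // Ee; ring.
have Bvv' : c * c' * Bf (std u a) (std u' a') = (l * m' + m * l') * e.
  transitivity (Bf v v'); last by rewrite Elm Elm' (Bf_comb two0) !Q0 // Ee; ring.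
  by rewrite Ec Ec' (BfZl two0) (BfZr two0) mulrA.
have : l * m * e != 0.
  by rewrite -Qv mulf_neq0 ?expf_neq0 ?(neq0_of_nsq (Kdef_nsq Aa)).
rewrite !mulf_eq0 !negb_or => /andP[/andP[l0 m0] e0].
have : l' * m' * e != 0.
  by rewrite -Qv' mulf_neq0 ?expf_neq0 ?(neq0_of_nsq (Kdef_nsq Aa')).
rewrite !mulf_eq0 !negb_or => /andP[/andP[l'0 m'0] _].
have B1 x y : Bf w (x *: w + y *: w') = y * e.
  by rewrite (Bf_combr two0) -(Bf_diag two0) Q0 // Ee !mulr0 add0r.
have B2 x y : Bf w' (x *: w + y *: w') = x * e.
  by rewrite (Bf_combr two0) -(Bf_diag two0) Q0 // (BfC two0) Ee !mulr0 addr0.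
have {Ht} Ht : t = m' * l / (m * l') \/ t = m * l' / (m' * l).
  case: Ht; rewrite /cross_ratio Elm Elm' !B1 !B2 => ->; [left|right]; field;
  by rewrite ?l0 ?m0 ?l'0 ?m'0 ?e0.
have t0 : t != 0.
  by case: Ht => ->; rewrite !(mulf_neq0, invr_eq0) ?l0 ?m0 ?l'0 ?m'0.
split=> //; apply: (mulfI (mulf_neq0 (expf_neq0 2 c0) (expf_neq0 2 c'0))).
transitivity ((t + 1) ^+ 2 * ((c ^+ 2 * a) * (c' ^+ 2 * a'))); first by ring.
transitivity (t * (c * c' * Bf (std u a) (std u' a')) ^+ 2); last by ring.
rewrite Qv Qv' Bvv'; case: Ht => ->; field; by rewrite ?l0 ?m0 ?l'0 ?m'0.
Qed.

(** * The action of PGL(2, k) *)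

Lemma C1_sym2 (p q r s : k) w : p * s - q * r != 0 ->
  C1 w -> C1 (sym2 p q r s *m w).
Proof.
move=> d0 C1w; have [x [y [xy Ew]]] := C1_inv C1w.
(* A vector of [C1] is the matrix h h^T with h = (x, y)^T, and g sends it to (g h)(g h)^T. *)
have -> : sym2 p q r s *m w = vec3 ((p * x + q * y) ^+ 2)
   ((p * x + q * y) * (r * x + s * y)) ((r * x + s * y) ^+ 2).
  by rewrite Ew; apply: col3P; rewrite sym2E !vec3E; ring.
apply: C1_param; apply: contraTT xy; rewrite !negb_or !negbK.
move=> /andP[/eqP E1 /eqP E2].
suff [-> ->] : x = 0 /\ y = 0 by rewrite eqxx.
split; apply: (mulfI d0).
  transitivity (s * (p * x + q * y) - q * (r * x + s * y)); first by ring.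
  by rewrite E1 E2; ring.
transitivity (p * (r * x + s * y) - r * (p * x + q * y)); first by ring.
by rewrite E1 E2; ring.
Qed.

Lemma H_sym2 (p q r s : k) v : p * s - q * r != 0 ->
  H_ abar v -> H_ abar (sym2 p q r s *m v).
Proof.
move=> d0 Hv w C1w.
have : C1 (sym2 s (- q) (- r) p *m w).
  by apply: C1_sym2 => //; rewrite (_ : _ - _ = p * s - q * r) //; ring.
(* Adjunction: pairing the image of [v] with [w] amounts to pairing [v] with the image of [w] under
   the adjugate. *)
move=> /Hv; congr K; apply: (mulfI (expf_neq0 2 d0)).
by rewrite -(Bf_sym2 two0) sym2_adjr // (BfZr two0).
Qed.

Lemma mx_act_orbit (M : 'M[k]_3) v :
  mx_act M (orbit_K abar v) = orbit_K abar (M *m v).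
Proof.
apply/seteqP; split=> x.
  by move=> [_ [c Kc <-] <-]; exists c => //; rewrite scalemxAr.
by move=> [c Kc <-]; exists (c *: v); [exists c|rewrite scalemxAr].
Qed.

Lemma Isom_sym2 (p q r s : k) : p * s - q * r != 0 -> Isom abar (sym2 p q r s).
Proof.
move=> d0; split.
  have : ((p * s - q * r) ^- 2 *: sym2 s (- q) (- r) p) *m sym2 p q r s = 1%:M.
    have entry (N : 'M[k]_3) i j : N i j = (N *m delta_mx j (0 : 'I_1)) i 0.
      by rewrite -colE mxE.
    apply/matrixP => i j; rewrite [LHS]entry -mulmxA -scalemxAl.
    rewrite sym2_adj // scalerA mulVf ?expf_neq0 //.
    by rewrite scale1r !mxE eqxx andbT.
  by move=> /mulmx1_unit[].
apply/seteqP; split=> x.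
  move=> [_ [v Hv <-] <-]; exists (sym2 p q r s *m v); first exact: H_sym2.
  by rewrite mx_act_orbit.
move=> [v Hv <-]; exists (orbit_K abar (sym2 s (- q) (- r) p *m v)).
  exists (sym2 s (- q) (- r) p *m v) => //; apply: H_sym2 => //.
  by rewrite (_ : _ - _ = p * s - q * r) //; ring.
by rewrite mx_act_orbit sym2_adjr orbit_scale //; apply: K_sqr.
Qed.

Lemma sym2_preserves_Q (p q r s : k) : p * s - q * r != 0 ->
  proj_preserves_Q (sym2 p q r s).
Proof.
move=> d0; exists (p * s - q * r)^-1; first by rewrite invr_eq0.
by move=> v; rewrite QfZ Qf_sym2; field.
Qed.

Lemma automorphism_projective T : automorphism abar T ->
  exists M : 'M[k]_3,
    [/\ Isom abar M, proj_preserves_Q M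
      & forall p, D_ abar p -> T p = mx_act M p].
Proof.
move=> [[T_D _ _] _ T_dist].
(* [G] picks the standard representative of the image of each point, with 0 as a default outside
   [Kdef]. *)
have /choice[G HG] : forall x : k * k, exists v : 'cV[k]_3, Kdef x.2 ->
    exists u' a', [/\ Kdef a', v = std u' a' & T (pt x.1 x.2) = pt u' a'].
  move=> [u a]; have [Aa|nA] := pselect (Kdef a); last by exists 0.
  have [u' [a' [Aa' E]]] := D_inv (T_D _ (D_pt u Aa)).
  by exists (std u' a') => _; exists u', a'.
pose F u a := G (u, a).
have HF : preserves_dist Kdef F.
  split.
    move=> u a Aa; have [u' [a' [Aa' EF _]]] := HG (u, a) Aa.
    by rewrite /F EF Qf_std; apply: Kdef_nsq.
  move=> u a u' a' Aa Aa' cl.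
  have [dist line [t Ht]] := coline_long_line Aa Aa' cl.
  have [t0 Et] := mult_dist_invariant Aa Aa' Ht.
  have [x [b [Ab EF ET]]] := HG (u, a) Aa.
  have [x' [b' [Ab' EF' ET']]] := HG (u', a') Aa'.
  (* The same [t] lies in the distance of the images, so (t + 1)^2 / t computes both invariants. *)
  have := Ht; rewrite -T_dist //; [|exact: D_pt|exact: D_pt].
  rewrite ET ET' => /(mult_dist_invariant Ab Ab')[_ Et'].
  rewrite /F EF EF' !Qf_std -(Bf_std two0); apply: (mulfI t0).
  transitivity (t * Bf (std x b) (std x' b') ^+ 2 * (a * a')); first by ring.
  rewrite -Et'.
  transitivity ((t + 1) ^+ 2 * (a * a') * (b * b')); first by ring.
  by rewrite Et; ring.
have [a0 /Kdef_abar Aa0] := abar_mem.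
have [|p [q [r [s [d0 std_F]]]]] := rigidity two0 _ Aa0 Kdef_sq Kdef_nsq HF.
  by move=> ps bad; apply: square_near_all.
have d'0 : s * p - (- q) * (- r) != 0.
  by rewrite (_ : _ - _ = p * s - q * r) //; ring.
exists (sym2 s (- q) (- r) p); split.
- exact: Isom_sym2.
- exact: sym2_preserves_Q.
move=> x /D_inv[u [a [Aa ->]]]; rewrite /pt mx_act_orbit.
have [u' [a' [Aa' EF ->]]] := HG (u, a) Aa.
have [c Ec] := std_F u a Aa.
have Ec' : (p * s - q * r) ^+ 2 *: std u' a' =
    c *: (sym2 s (- q) (- r) p *m std u a).
  by rewrite -EF scalemxAr -Ec sym2_adj.
(* Comparing first coordinates in [Ec'] replaces the unknown scalar [c] by [y 0 0], which lies in
   [K]; so the orbits agree. *)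
have := H_first (H_sym2 d'0 (H_std u Aa)).
move: (_ *m std u a) Ec' => y Ec' Ky.
have c1 : std u' a' = (y 0 0)^-1 *: y.
  have d20 := expf_neq0 2 d0; have y0 := K_neq0 Ky.
  have /matrixP/(_ 0 0) E0 := Ec'.
  rewrite !mxE /= mulr1 in E0.
  apply: (scalerI d20); rewrite Ec' E0 scalerA -mulrA mulfV // mulr1 //.
by rewrite /pt c1 orbit_scale //; apply: K_inv.
Qed.

End Transfer.

Theorem theorem6p2 (k : fieldType) (k_local : nonarch_local_field k)
    (k_char : 2%N \notin [pchar k])
    (abar : set k) (abar_class : square_class abar) (abarN1 : ~ abar (- 1))
    (T : set 'cV[k]_3 -> set 'cV[k]_3) (T_aut : automorphism abar T) :
  exists M : 'M[k]_3,
    [/\ Isom abar M, proj_preserves_Q M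
      & forall p, D_ abar p -> T p = mx_act M p].
Proof.
have two0 : (2 : k) != 0 by move: k_char; rewrite !inE /=.
exact: automorphism_projective.
Qed.
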